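(* Let $d\ge 2$, let $\Omega\subset\mathbb{R}^d$ be a bounded domain with Lipschitz boundary, let $\mu\in L^\infty(\Omega)$ with $\mu\ge 0$ a.e., and let $p,q:\Omega\times[0,\infty)\to[2,\infty)$ be Carathéodory functions satisfying: (a) $2\le p^-:=\operatorname{ess\,inf}_{\Omega\times[0,\infty)}p\le p^+:=\operatorname{ess\,sup}_{\Omega\times[0,\infty)}p\le d$, $\ 2\le q^-:=\operatorname{ess\,inf}_{\Omega\times[0,\infty)}q\le q^+:=\operatorname{ess\,sup}_{\Omega\times[0,\infty)}q<+\infty$, and $p(x,t)\le q(x,t)$ for a.a. $x\in\Omega$ and all $t\ge0$; (b) for a.a. $x\in\Omega$ the functions $t\mapsto p(x,t)$ and $t\mapsto q(x,t)$ are continuous, constant on $[0,1]$ (equal to some $p(x)$ and $q(x)$ respectively), and nondecreasing on $[1,\infty)$; (c) $\mu\in C^{0,1}(\overline\Omega)$, and there exist $c_p,c_q>0$ with $|p(x,t)-p(y,t)|\le c_p|x-y|$ and $|q(x,t)-q(y,t)|\le c_q|x-y|$ for all $t\ge 0$ and all $x,y\in\Omega$; (d) $\frac{q^+}{p^-}<1+\frac1d$. Then there exists a constant $C>0$, independent of $u$, such that $$\|u\|_{L^{\mathcal{H}}(\Omega)}\le C\,\|\nabla u\|_{L^{\mathcal{H}}(\Omega)}\qquad\text{for all }u\in W_0^{1,\mathcal{H}}(\Omega).$$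
   Context: $h(x,t)=|t|^{p(x,|t|)-2}t+\mu(x)|t|^{q(x,|t|)-2}t$ for $t\ne0$, $h(x,0)=0$; $\mathcal{H}(x,t)=\int_0^t h(x,s)\,ds$. $L^{\mathcal{H}}(\Omega)=\{u \text{ measurable}:\rho_{\mathcal H}(u):=\int_\Omega\mathcal{H}(x,u)\,dx<\infty\}$ with the Luxemburg norm $\|u\|_{L^{\mathcal H}(\Omega)}=\inf\{\lambda>0:\rho_{\mathcal{H}}(u/\lambda)\le1\}$, and $\|\nabla u\|_{L^{\mathcal{H}}(\Omega)}:=\||\nabla u|\|_{L^{\mathcal{H}}(\Omega)}$. $W^{1,\mathcal{H}}(\Omega)=\{u\in L^{\mathcal{H}}(\Omega):|\nabla u|\in L^{\mathcal{H}}(\Omega)\}$ with norm $\|u\|_{L^{\mathcal{H}}(\Omega)}+\|\nabla u\|_{L^{\mathcal{H}}(\Omega)}$, and $W_0^{1,\mathcal{H}}(\Omega)$ is the completion of $C_0^\infty(\Omega)$ in $W^{1,\mathcal{H}}(\Omega)$. *)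

(* Defs.v *)
From HB Require Import structures.
From mathcomp Require Import all_boot all_order all_algebra.
From mathcomp Require Import all_classical all_reals all_analysis ess_sup_inf.

Set Implicit Arguments.
Unset Strict Implicit.
Unset Printing Implicit Defensive.

Import Order.TTheory GRing.Theory Num.Theory.
Import numFieldNormedType.Exports.

Local Open Scope classical_set_scope.
Local Open Scope ring_scope.

Section rV_measurable.
Context d (T : measurableType d) (n : nat).

Let coor (i : 'I_n) (x : 'rV[T]_n) : T := x ord0 i.

Let rV0 : g_sigma_preimage coor set0.
Proof. exact: sigma_algebra0. Qed.

Let rVC A : g_sigma_preimage coor A -> g_sigma_preimage coor (~` A).
Proof. exact: sigma_algebraC. Qed.

Let rVU (F : _^nat) : (forall i, g_sigma_preimage coor (F i)) ->
  g_sigma_preimage coor (\bigcup_i (F i)).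
Proof. exact: sigma_algebra_bigcup. Qed.

HB.instance Definition _ := @isMeasurable.Build
  (measure_tuple_display d) 'rV[T]_n (g_sigma_preimage coor) rV0 rVC rVU.

End rV_measurable.

Section lebesgue_rV.
Context (R : realType).
Local Open Scope ereal_scope.

Definition cons_rV (n : nat) (x : measurableTypeR R * 'rV[R]_n) : 'rV[R]_n.+1 :=
  row_mx (x.1%:M : 'rV[R]_1) x.2.

(* d-dimensional Lebesgue measure, as an iterated product measure. *)
Fixpoint lebesgue_rV (n : nat) : set 'rV[R]_n -> \bar R :=
  match n return set 'rV[R]_n -> \bar R with
  | 0%N => dirac (0%R : 'rV[R]_0)
  | n'.+1 => pushforward (lebesgue_measure \x @lebesgue_rV n') (@cons_rV n')
  end.

Lemma measurable_coord_rV n (i : 'I_n) :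
  measurable_fun [set: 'rV[R]_n] (fun x => x ord0 i).
Proof.
move=> _ Y mY; rewrite setTI; apply: sub_sigma_algebra => /=.
rewrite -bigcup_seq/=; exists i => /=; first by rewrite mem_index_enum.
by exists Y => //; rewrite setTI.
Qed.

Lemma measurable_fun_rVP d (T : measurableType d) n (f : T -> 'rV[R]_n) :
  (forall i, measurable_fun [set: T] (fun x => f x ord0 i)) ->
  measurable_fun [set: T] f.
Proof.
move=> mf _ Y; rewrite setTI.
have sub : g_sigma_preimage (fun (i : 'I_n) (x : 'rV[R]_n) => x ord0 i) `<=`
    [set A | measurable (f @^-1` A)].
  apply: smallest_sub.
    split => /=.
    - by rewrite preimage_set0; exact: measurable0.
    - by move=> A mA; rewrite setTD -preimage_setC; exact: measurableC.
    - by move=> F mF; rewrite preimage_bigcup; exact: bigcupT_measurable.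
  rewrite -bigcup_seq => A [i _ [B mB <-]] /=.
  rewrite setTI -[X in measurable X]setTI; exact: mf.
exact: sub.
Qed.

Lemma cons_rV0 n x : @cons_rV n x ord0 ord0 = x.1.
Proof.
rewrite (_ : ord0 = lshift n (ord0 : 'I_1)); last exact/val_inj.
by rewrite (row_mxEl (x.1%:M : 'rV[R]_1) x.2) mxE eqxx mulr1n.
Qed.

Lemma cons_rVS n x (i : 'I_n) : @cons_rV n x ord0 (lift ord0 i) = x.2 ord0 i.
Proof.
rewrite (_ : lift ord0 i = rshift 1 i); last exact/val_inj.
exact: (row_mxEr (x.1%:M : 'rV[R]_1) x.2).
Qed.

Lemma measurable_cons_rV n : measurable_fun setT (@cons_rV n).
Proof.
apply: measurable_fun_rVP => i; have [j ->|->] := unliftP ord0 i.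
- under eq_fun do rewrite cons_rVS.
  exact: (measurableT_comp (measurable_coord_rV j) measurable_snd).
- under eq_fun do rewrite cons_rV0.
  exact: measurable_fst.
Qed.

Definition uncons_rV n (x : 'rV[R]_n.+1) : measurableTypeR R * 'rV[R]_n :=
  (x ord0 ord0, \row_i x ord0 (lift ord0 i)).

Lemma uncons_rVK n : cancel (@uncons_rV n) (@cons_rV n).
Proof.
move=> x; apply/rowP => i; have [j ->|->] := unliftP ord0 i.
  by rewrite cons_rVS mxE.
by rewrite cons_rV0.
Qed.

Lemma cons_rVK n : cancel (@cons_rV n) (@uncons_rV n).
Proof.
move=> [t x]; rewrite /uncons_rV cons_rV0; congr pair.
by apply/rowP => j; rewrite mxE cons_rVS.
Qed.

Lemma measurable_uncons_rV n : measurable_fun setT (@uncons_rV n).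
Proof.
apply: measurable_fun_pair; first exact: measurable_coord_rV.
apply: measurable_fun_rVP => i; under eq_fun do rewrite mxE.
exact: measurable_coord_rV.
Qed.

Section step.
Context (n : nat) (m : {sigma_finite_measure set 'rV[R]_n -> \bar R}).

Let mu : set 'rV[R]_n.+1 -> \bar R :=
  pushforward (lebesgue_measure \x m) (@cons_rV n).

Let mu0 : mu set0 = 0.
Proof. by rewrite /mu /pushforward preimage_set0 measure0. Qed.

Let mu_ge0 A : 0 <= mu A.
Proof. exact: (measure_ge0 (lebesgue_measure \x m)). Qed.

Let mpre A : measurable A -> measurable (@cons_rV n @^-1` A).
Proof.
by move=> mA; rewrite -[X in measurable X]setTI; exact: measurable_cons_rV.
Qed.

Let mu_sigma_additive : semi_sigma_additive mu.
Proof.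
move=> F mF tF mUF; rewrite /mu /pushforward preimage_bigcup.
apply: measure_semi_sigma_additive.
- by move=> k; exact: mpre.
- apply/trivIsetP => /= i j _ _ ij; rewrite -preimage_setI.
  by move/trivIsetP : tF => /(_ _ _ _ _ ij) ->//; rewrite preimage_set0.
- by rewrite -preimage_bigcup; exact: mpre.
Qed.

HB.instance Definition _ :=
  isMeasure.Build _ _ _ mu mu0 mu_ge0 mu_sigma_additive.

Let mu_sigma_finite : sigma_finite setT mu.
Proof.
have /sigma_finiteP[F [TF ndF Foo]] := sigma_finiteT (@lebesgue_measure R).
have /sigma_finiteP[G [TG ndG Goo]] := sigma_finiteT m.
exists (fun k => @uncons_rV n @^-1` (F k `*` G k)).
  rewrite -preimage_bigcup -[LHS](preimage_setT (@uncons_rV n)).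
  congr (_ @^-1` _); rewrite -setXTT TF TG predeqE => -[x y]; split.
    move=> [/= [j _ Fjx] [k _ Gky]]; exists (maxn j k) => //; split.
    - by move: x Fjx; exact/subsetPset/ndF/leq_maxl.
    - by move: y Gky; exact/subsetPset/ndG/leq_maxr.
  by move=> [j _ []/= ? ?]; split; exists j.
move=> k; have [mF Fk] := Foo k; have [mG Gk] := Goo k; split.
  rewrite -[X in measurable X]setTI; apply: measurable_uncons_rV => //.
  exact: measurableX.
rewrite /mu /pushforward -comp_preimage (_ : _ \o _ = idfun); last first.
  by apply/funext => x /=; rewrite cons_rVK.
by rewrite preimage_id product_measure1E// lte_mul_pinfty// ge0_fin_numE.
Qed.

HB.instance Definition _ :=
  Measure_isSigmaFinite.Build _ _ _ mu mu_sigma_finite.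

Lemma lebesgue_rV_step :
  exists m' : {sigma_finite_measure set 'rV[R]_n.+1 -> \bar R},
    m' = mu :> (set _ -> \bar R).
Proof. by exists mu. Qed.

End step.

Lemma lebesgue_rV_is_measure n :
  exists m : {sigma_finite_measure set 'rV[R]_n -> \bar R},
    m = @lebesgue_rV n :> (set _ -> \bar R).
Proof.
elim: n => [|n [m mE]]; first by exists (dirac (0%R : 'rV[R]_0)).
by have [m' m'E] := lebesgue_rV_step m; exists m'; rewrite m'E mE.
Qed.

Section instances.
Variable n : nat.

Let leb0 : @lebesgue_rV n set0 = 0.
Proof. by have [m <-] := lebesgue_rV_is_measure n; exact: measure0. Qed.

Let leb_ge0 A : 0 <= @lebesgue_rV n A.
Proof. by have [m <-] := lebesgue_rV_is_measure n; exact: measure_ge0. Qed.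

Let leb_sigma_additive : semi_sigma_additive (@lebesgue_rV n).
Proof.
by have [m <-] := lebesgue_rV_is_measure n; exact: measure_semi_sigma_additive.
Qed.

HB.instance Definition _ := isMeasure.Build _ _ _ (@lebesgue_rV n)
  leb0 leb_ge0 leb_sigma_additive.

Let leb_sigma_finite : sigma_finite setT (@lebesgue_rV n).
Proof. by have [m <-] := lebesgue_rV_is_measure n; exact: sigma_finiteT. Qed.

HB.instance Definition _ := Measure_isSigmaFinite.Build _ _ _ (@lebesgue_rV n)
  leb_sigma_finite.

End instances.

End lebesgue_rV.
Arguments lebesgue_rV {R n}.

Section euclidean.
Context {R : realType}.

(* The norm `|x| of 'rV[R]_d is the sup norm. *)
Definition enorm d (x : 'rV[R]_d) : R := Num.sqrt (\sum_i x ord0 i ^+ 2).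

(* Near each boundary point, and up to an isometry Q of R^d, the set is the
   strict epigraph of a Lipschitz function of the coordinates other than i. *)
Definition lipschitz_boundary d (Omega : set 'rV[R]_d) : Prop :=
  forall x0, (closure Omega `\` Omega°) x0 ->
    exists (Q : 'M[R]_d) (i : 'I_d) (g : 'rV[R]_d.-1 -> R) (L r : R),
      [/\ Q *m Q^T = 1%:M,
          forall y z, `|g y - g z| <= L * enorm (y - z),
          0 < r &
          forall x, enorm (x - x0) < r ->
            (Omega x <-> g (col' i (x *m Q)) < (x *m Q) ord0 i)].

Definition is_domain d (Omega : set 'rV[R]_d) : Prop :=
  [/\ Omega !=set0, open Omega & connected Omega].

Definition lipschitz_on_set d (D : set 'rV[R]_d) (f : 'rV[R]_d -> R) : Prop :=
  exists c : R, forall x y, D x -> D y -> `|f x - f y| <= c * enorm (x - y).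

(* Measurability on D with respect to the completed sigma-algebra. *)
Definition lebesgue_measurable d (D : set 'rV[R]_d) (f : 'rV[R]_d -> R) : Prop :=
  exists2 g : 'rV[R]_d -> R, measurable_fun D g &
    {ae lebesgue_rV, forall x, D x -> f x = g x}.

Definition caratheodory d (D : set 'rV[R]_d) (p : 'rV[R]_d -> R -> R) : Prop :=
  (forall t, 0 <= t -> lebesgue_measurable D (p ^~ t)) /\
  {ae lebesgue_rV, forall x, D x -> {within `[0, +oo[, continuous (p x)}}.

End euclidean.

Section essential_bounds.
Context d (T : measurableType d) (R : realType).
Variable m : {measure set T -> \bar R}.

Definition ess_sup_on (D : set T) (f : T -> R) : \bar R :=
  ess_sup m (patch (cst -oo%E) D (EFin \o f)).

Definition ess_inf_on (D : set T) (f : T -> R) : \bar R :=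
  ess_inf m (patch (cst +oo%E) D (EFin \o f)).

End essential_bounds.

Section exponent_bounds.
Context {R : realType} (d : nat).
Implicit Types (D : set 'rV[R]_d) (p : 'rV[R]_d -> R -> R).

Definition exponent_sup D p : \bar R :=
  ess_sup_on (@lebesgue_rV R d \x @lebesgue_measure R)%E
    (D `*` `[0, +oo[) (fun z => p z.1 z.2).

Definition exponent_inf D p : \bar R :=
  ess_inf_on (@lebesgue_rV R d \x @lebesgue_measure R)%E
    (D `*` `[0, +oo[) (fun z => p z.1 z.2).

Definition exponent_growth (r : R -> R) : Prop :=
  [/\ {within `[0, +oo[, continuous r},
      exists c, forall t, 0 <= t <= 1 -> r t = c &
      forall s t, 1 <= s -> s <= t -> r s <= r t].

End exponent_bounds.

Section weak_derivatives.
Context {R : realType} (d : nat).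
Implicit Types (Omega : set 'rV[R]_d) (u f phi : 'rV[R]_d -> R)
  (G : 'rV[R]_d -> 'rV[R]_d).

Definition partial (i : 'I_d) f : 'rV[R]_d -> R :=
  fun x => 'D_(delta_mx ord0 i) f x.

Definition gradient f : 'rV[R]_d -> 'rV[R]_d := fun x => \row_i partial i f x.

Definition smooth f : Prop :=
  forall s : seq 'I_d, continuous (foldr partial f s) /\
    forall i x, derivable (foldr partial f s) x (delta_mx ord0 i).

Definition test_function Omega phi : Prop :=
  let supp := closure [set x | phi x != 0] in
  [/\ smooth phi, compact supp & supp `<=` Omega].

Definition locally_integrable Omega f : Prop :=
  lebesgue_measurable Omega f /\
  forall K, compact K -> K `<=` Omega ->
    (\int[lebesgue_rV]_(x in K) `|f x|%:E < +oo)%E.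

Definition weak_gradient Omega u G : Prop :=
  [/\ locally_integrable Omega u,
      forall i, locally_integrable Omega (fun x => G x ord0 i) &
      forall phi, test_function Omega phi -> forall i,
        \int[lebesgue_rV]_(x in Omega) (u x * partial i phi x) =
        - \int[lebesgue_rV]_(x in Omega) (G x ord0 i * phi x)].

End weak_derivatives.

Section musielak_orlicz.
Context {R : realType} (d : nat).
Variables (p q : 'rV[R]_d -> R -> R) (mu : 'rV[R]_d -> R).
Variable Omega : set 'rV[R]_d.
Implicit Types (x : 'rV[R]_d) (u : 'rV[R]_d -> R) (G : 'rV[R]_d -> 'rV[R]_d).

Definition small_h x (t : R) : R :=
  if t == 0 then 0
  else `|t| `^ (p x `|t| - 2) * t + mu x * `|t| `^ (q x `|t| - 2) * t.

(* The oriented integral of small_h x from 0 to t. *)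
Definition big_H x (t : R) : R :=
  if 0 <= t then \int[lebesgue_measure]_(s in `[0, t]) small_h x s
  else - \int[lebesgue_measure]_(s in `[t, 0]) small_h x s.

Definition rho_H u : \bar R :=
  (\int[lebesgue_rV]_(x in Omega) (big_H x (u x))%:E)%E.

Definition in_LH u : Prop :=
  lebesgue_measurable Omega u /\ (rho_H u < +oo)%E.

Definition LH_norm u : \bar R :=
  ereal_inf [set l%:E | l in
    [set l : R | 0 < l /\ (rho_H (fun x => (u x / l)%R) <= 1)%E]].

Definition LH_norm_vec G : \bar R := LH_norm (fun x => enorm (G x)).

(* Elements of W^{1,H} are presented together with their weak gradient G,
   which is unique up to null sets. *)
Definition in_W1H u G : Prop :=
  [/\ in_LH u, weak_gradient Omega u G & in_LH (fun x => enorm (G x))].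

Definition W1H_norm u G : \bar R := (LH_norm u + LH_norm_vec G)%E.

(* The closure of the test functions in W^{1,H}. *)
Definition in_W01H u G : Prop :=
  in_W1H u G /\
  forall e : R, 0 < e -> exists2 phi, test_function Omega phi &
    (W1H_norm (fun x => (u x - phi x)%R)
              (fun x => (G x - gradient phi x)%R) < e%:E)%E.

End musielak_orlicz.

(* Main.v *)
Require Import Defs.
From mathcomp Require Import all_boot all_order all_algebra.
From mathcomp Require Import all_classical all_reals all_analysis ess_sup_inf.
From mathcomp Require Import measurable_realfun ring lra.

Set Implicit Arguments.
Unset Strict Implicit.
Unset Printing Implicit Defensive.

Import Order.TTheory GRing.Theory Num.Theory.
Import numFieldNormedType.Exports.

Local Open Scope classical_set_scope.
Local Open Scope ring_scope.

(** Write P for the essential infimum of p and Q for the essential supremum of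
    q (or P, if larger), so that P <= Q < P (1 + 1/d).  Up to constants H(x, t)
    lies between |t|^P - 1 and t^2 + |t|^Q for almost every x, so on the bounded
    set Omega it suffices to prove that a bound l^P on the integral of
    |grad u|^P forces a bound K l^Q on the integral of |u|^Q.

    For test functions this is a weak Gagliardo-Nirenberg inequality: if f >= 0
    is supported in a box and dominated on every line parallel to an axis by the
    integral of g along that line, and g has integral at most 1, then the
    integral of f^(1 + 1/d) is at most a constant.  The exponent 1 + 1/d is the
    one that can be obtained by induction on d from slicing alone.  It is applied
    to multiples of f = |phi|^P and g = P |phi|^(P-1) |grad phi|; the integral of
    g is controlled by Young's inequality and the Poincare inequality in L^1.

    For u in the closure of the test functions, the truncations min(|u|, m) are
    compared with an approximating test function phi, the error
    m^(Q-P) |u - phi|^P tends to 0, and then m tends to infinity. *)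

(** * Monotonicity of the integral without measurability *)

Section monotone_integral.
Local Open Scope ereal_scope.
Context d (T : measurableType d) (R : realType).
Variable m : {measure set T -> \bar R}.
Implicit Types (f g : T -> \bar R) (D N : set T).
Import HBNNSimple.

(** A simple function below [f] keeps its integral when cut off on the null set [N], and after the
    cut it lies below [g] everywhere. *)
Let ge0_integral_monotone_ae N D f g : measurable N -> m N = 0 ->
  (forall x, 0 <= f x) -> (forall x, 0 <= g x) ->
  (forall x, D x -> ~ N x -> f x <= g x) ->
  \int[m]_(x in D) f x <= \int[m]_(x in D) g x.
Proof.
move=> mN N0 f0 g0 fg; rewrite ge0_integralE// ge0_integralE//.
apply: ge_ereal_sup => _ [h hf <-].
have mNC := measurableC mN.
rewrite -integralT_nnsfun.
have -> : \int[m]_x (h x)%:E = \int[m]_x (proj_nnsfun h mNC x)%:E.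
  apply: ge0_ae_eq_integral => //.
  - exact/measurable_EFinP.
  - exact/measurable_EFinP.
  - by move=> x _; rewrite lee_fin.
  - by move=> x _; rewrite lee_fin.
  - exists N; split => // x /= hx; apply: contrapT => Nx; apply: hx => _.
    by rewrite mindicE mem_set// mulr1.
rewrite integralT_nnsfun; apply: ereal_sup_ubound => /=.
exists (proj_nnsfun h mNC) => // x /=.
rewrite mindicE; have [Nx|Nx] := boolP (x \in ~` N); last first.
  by rewrite mulr0 patchE; case: ifP.
rewrite mulr1; apply: (le_trans (hf x)); rewrite !patchE; case: ifPn => // Dx.
by apply: fg; [exact: set_mem|exact: set_mem Nx].
Qed.

(* The integral of a nonnegative function is a supremum over simple functions,
   so monotonicity needs no measurability. *)
Lemma integral_monotone_ae D f g : {ae m, forall x, D x -> f x <= g x} ->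
  \int[m]_(x in D) f x <= \int[m]_(x in D) g x.
Proof.
move=> [N [mN N0 subN]].
have fg x : D x -> ~ N x -> f x <= g x.
  by move=> Dx Nx; apply: contrapT => fgx; apply/Nx/subN => /= /(_ Dx).
rewrite [leLHS]integralE [leRHS]integralE; apply: leeB.
- apply: (ge0_integral_monotone_ae mN) => // x Dx Nx; rewrite !funeposE.
  by rewrite ge_max le_max fg//= le_max lexx orbT.
- apply: (ge0_integral_monotone_ae mN) => // x Dx Nx; rewrite !funenegE.
  by rewrite ge_max !le_max leeN2 fg//= lexx orbT.
Qed.

Lemma integral_monotone D f g : (forall x, D x -> f x <= g x) ->
  \int[m]_(x in D) f x <= \int[m]_(x in D) g x.
Proof. by move=> fg; apply: integral_monotone_ae; exact: aeW. Qed.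

Lemma integral_monotone_mkset D f : (forall x, 0 <= f x) ->
  \int[m]_(x in D) f x <= \int[m]_x f x.
Proof.
move=> f0; rewrite integral_mkcond; apply: integral_monotone => x _.
by rewrite patchE; case: ifP.
Qed.

Lemma eq_integral_supp D f : (forall x, ~ D x -> f x = 0) ->
  \int[m]_(x in D) f x = \int[m]_x f x.
Proof.
move=> f0; rewrite integral_mkcond; apply: eq_integral => x _.
by rewrite patchE; case: ifPn => // /negP Dx; rewrite f0// => /mem_set.
Qed.

End monotone_integral.

(** * Borel measurability of open sets and continuous functions *)

Section borel_rV.
Context (R : realType).

(** The sigma-algebra is generated by the coordinates, so [U] is written as the union of the
    countably many cubes with rational centre and half-side [1 / (k + 1)] that it contains. *)
Lemma open_measurable_rV n (U : set 'rV[R]_n) : open U -> measurable U.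
Proof.
move=> oU.
pose c (z : 'rV[rat]_n) : 'rV[R]_n := map_mx ratr z.
pose B (w : 'rV[rat]_n * nat) := [set x : 'rV[R]_n |
  forall i, `|x ord0 i - c w.1 ord0 i| < w.2.+1%:R^-1].
have -> : U = \bigcup_(w in [set w | B w `<=` U]) B w.
  apply/seteqP; split => [x Ux|x [w /= + ]]; last exact.
  have /nbhs_ballP[e /= e0 eU] := oU x Ux.
  (* Half of the radius: a point of the cube and [x] are both within [1 / (k + 1)] of the centre,
     hence within [e] of each other. *)
  have [k ke] : exists k : nat, k.+1%:R^-1 < e / 2.
    have e2 : 0 < e / 2 by rewrite divr_gt0.
    by near \oo => k; exists k; near: k; exact: (near_infty_natSinv_lt (PosNum e2)).
  have cz (i : 'I_n) : exists z : rat, `|x ord0 i - ratr z| < k.+1%:R^-1.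
    have : 0 < k.+1%:R^-1 :> R by [].
    move: (k.+1%:R^-1) => r r0.
    have : x ord0 i - r < x ord0 i + r by lra.
    move=> /rat_in_itvoo[z]; rewrite in_itv/= => /andP[z1 z2].
    by exists z; rewrite ltr_norml; apply/andP; split; lra.
  pose z := \row_i sval (cid (cz i)).
  have zP i : `|x ord0 i - c z ord0 i| < k.+1%:R^-1.
    by rewrite /c !mxE; case: cid.
  exists (z, k) => //= y By; apply: eU.
  rewrite mx_norm_ball /ball_/= [ltLHS]mx_normrE; apply/bigmax_ltP; split => //= i _.
  rewrite !mxE (ord1 i.1).
  have -> : x ord0 i.2 - y ord0 i.2 = (x ord0 i.2 - c z ord0 i.2) -
    (y ord0 i.2 - c z ord0 i.2) by ring.
  rewrite (le_lt_trans (ler_normB _ _))//.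
  by rewrite [e]splitr ltrD// (lt_trans _ ke).
rewrite bigcup_mkcond; apply: countable_bigcupT_measurable => [|w].
  exact/countableP.
case: ifPn => // _.
rewrite (_ : B w = \bigcap_(i in [set: 'I_n])
  (fun x : 'rV[R]_n => x ord0 i) @^-1` [set s | `|s - c w.1 ord0 i| < w.2.+1%:R^-1]).
  apply: fin_bigcap_measurable; first exact: finite_finset.
  move=> i _; rewrite -[X in measurable X]setTI; apply: measurable_coord_rV => //.
  rewrite (_ : [set s | _] = ball (c w.1 ord0 i) w.2.+1%:R^-1).
    exact: measurable_ball.
  by apply/seteqP; split => s /=; rewrite /ball/= distrC.
by apply/seteqP; split => x /= h i; [move=> _; exact: h|exact: h].
Unshelve. all: by end_near. Qed.

Lemma continuous_measurable_rV n (f : 'rV[R]_n -> R) :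
  continuous f -> measurable_fun setT f.
Proof.
move=> cf; apply: (measurability _ (RGenOpens.measurableE R)) => _ [_ [a [b ->] <-]].
rewrite setTI; apply: open_measurable_rV.
by move/continuousP : cf; apply; exact: interval_open.
Qed.

End borel_rV.

(** * Iterated integrals on row vectors *)

Section lebesgue_rV_fubini.
Context (R : realType).
Local Open Scope ereal_scope.
Notation leb := (@lebesgue_measure R).

Section slices.
Context (n : nat) (F : 'rV[R]_n.+1 -> \bar R).
Hypotheses (mF : measurable_fun setT F) (F0 : forall x, 0 <= F x).

Let mFc : measurable_fun setT (F \o @cons_rV R n).
Proof. exact: (measurableT_comp mF (@measurable_cons_rV R n)). Qed.

(** In dimension [n.+1] the measure is by definition the image under [cons_rV] of a product measure,
    so Tonelli's theorem applies. *)
Lemma ge0_integral_cons_rV : \int[lebesgue_rV]_x F x =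
  \int[leb]_t \int[lebesgue_rV]_x F (cons_rV (t, x)).
Proof.
transitivity (\int[pushforward (leb \x @lebesgue_rV R n) (@cons_rV R n)]_x F x).
  by [].
rewrite ge0_integral_pushforward//; last exact: measurable_cons_rV.
rewrite preimage_setT (fubini_tonelli1 (F \o @cons_rV R n)) //.
by move=> x; exact: F0.
Qed.

Lemma ge0_integral_cons_rV2 : \int[lebesgue_rV]_x F x =
  \int[lebesgue_rV]_x \int[leb]_t F (cons_rV (t, x)).
Proof.
rewrite ge0_integral_cons_rV.
rewrite (fubini_tonelli (F \o @cons_rV R n)) //.
by move=> x; exact: F0.
Qed.

Lemma measurable_integral_cons_rV1 :
  measurable_fun setT (fun t : measurableTypeR R => \int[lebesgue_rV]_x F (cons_rV (t, x))).
Proof.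
apply: (measurable_fun_fubini_tonelli_F (F \o @cons_rV R n)) => //.
by move=> x; exact: F0.
Qed.

End slices.

Lemma measurable_cons_rVr n t :
  measurable_fun setT (fun x : 'rV[R]_n => cons_rV (t, x)).
Proof.
apply: (measurableT_comp (@measurable_cons_rV R n)).
exact: measurable_pair1.
Qed.

(** A closed cube: under [cons_rV] it becomes an interval times a cube of one dimension less, which
    suits induction on [n]. *)
Definition box n (L : R) := [set x : 'rV[R]_n | forall i, (`|x ord0 i| <= L)%R].

Lemma measurable_box n L : measurable (@box n L).
Proof.
rewrite (_ : box L = \bigcap_(i in [set: 'I_n])
  (fun x : 'rV[R]_n => x ord0 i) @^-1` `[(- L)%R, L]).
  apply: fin_bigcap_measurable; first exact: finite_finset.
  by move=> i _; rewrite -[X in measurable X]setTI; exact: measurable_coord_rV.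
apply/seteqP; split => x /= h i; first by move=> _; rewrite /= in_itv/= -ler_norml; exact: h.
by have := h i Logic.I; rewrite /= in_itv/= -ler_norml.
Qed.

Lemma box_cons n L t (x : 'rV[R]_n) :
  box L (cons_rV (t, x)) <-> (`|t| <= L)%R /\ box L x.
Proof.
split => [h|[tL xL] i].
  split; first by have := h ord0; rewrite cons_rV0.
  by move=> i; have := h (lift ord0 i); rewrite cons_rVS.
by have [j ->|->] := unliftP ord0 i; rewrite ?cons_rV0 ?cons_rVS//=; exact: xL.
Qed.

Lemma lebesgue_box n L : lebesgue_rV (@box n L) < +oo.
Proof.
elim: n => [|n ih].
  by rewrite /lebesgue_rV diracE ltry.
have boxE : @cons_rV R n @^-1` box L = `[(- L)%R, L] `*` box L.
  apply/seteqP; split => -[t x] /=.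
    by move=> /box_cons[tL ?]; split => //=; rewrite in_itv/= -ler_norml.
  by move=> [/=]; rewrite in_itv/= -ler_norml => ? ?; exact/box_cons.
change ((leb \x @lebesgue_rV R n) (@cons_rV R n @^-1` box L) < +oo).
rewrite boxE product_measure1E//; last exact: measurable_box.
have LL : lebesgue_measure (`[(- L)%R, L]%classic : set R) < +oo.
  by rewrite lebesgue_measure_itv/=; case: ifP => _; rewrite -?EFinB ltry.
by apply: lte_mul_pinfty => //; rewrite ge0_fin_numE.
Qed.

End lebesgue_rV_fubini.

(** * A weak Gagliardo-Nirenberg inequality *)

Section real_integrands.
Context d (T : measurableType d) (R : realType).
Variable m : {measure set T -> \bar R}.
Implicit Types (f g : T -> R) (D : set T).
Local Open Scope ereal_scope.

Lemma ge0_integralZl_real D f (k : R) : measurable D -> measurable_fun D f ->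
  (forall x, 0 <= f x)%R -> (0 <= k)%R ->
  \int[m]_(x in D) (k * f x)%:E = k%:E * \int[m]_(x in D) (f x)%:E.
Proof.
move=> mD mf f0 k0; under eq_integral do rewrite EFinM.
rewrite ge0_integralZl_EFin// => [x _|]; first by rewrite lee_fin.
exact/measurable_EFinP.
Qed.

Lemma ge0_integralD_real D f g : measurable D ->
  measurable_fun D f -> measurable_fun D g ->
  (forall x, 0 <= f x)%R -> (forall x, 0 <= g x)%R ->
  \int[m]_(x in D) (f x + g x)%:E =
  \int[m]_(x in D) (f x)%:E + \int[m]_(x in D) (g x)%:E.
Proof.
move=> mD mf mg f0 g0; under eq_integral do rewrite EFinD.
rewrite ge0_integralD//; [|exact/measurable_EFinP| |exact/measurable_EFinP];
  by move=> x _; rewrite lee_fin.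
Qed.

Lemma measurable_powR_fun D f r : measurable_fun D f ->
  measurable_fun D (fun x => f x `^ r)%R.
Proof. exact: (measurableT_comp (measurable_powR r)). Qed.

End real_integrands.

Section slice_power.
Context (R : realType).

Lemma ler_powR2r (r x y : R) : 0 <= r -> 0 <= x -> x <= y -> x `^ r <= y `^ r.
Proof.
by move=> r0 x0 xy; apply: ge0_ler_powR => //; rewrite nnegrE// (le_trans x0).
Qed.

(* In the induction on the dimension, [b] bounds the mass of [g] on a slice:
   then the slice of [f / b] falls under the induction hypothesis, and both
   terms of the bound integrate to a multiple of [b]. *)
Lemma powR_slice n (f b : R) : (0 < n)%N -> 0 <= f -> 0 < b ->
  f `^ (1 + n.+1%:R^-1) <= b * f + b * (f / b) `^ (1 + n%:R^-1).
Proof.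
move=> n0; rewrite le_eqVlt => /predU1P[<- b0|f0 b0].
  by rewrite mulr0 mul0r !powR0 ?mulr0 ?addr0// gt_eqF// ltr_wpDr// invr_ge0.
have fb0 : 0 < f / b by rewrite divr_gt0.
rewrite !powRD ?gt_eqF ?implybT// !powRr1 ?(ltW f0) ?(ltW fb0)//.
rewrite mulrA [b * (f / b)]mulrC divfK ?gt_eqF//.
set z := f `^ n.+1%:R^-1.
have z0 : 0 < z by rewrite powR_gt0.
have zf : z ^+ n.+1 = f.
  by rewrite -powR_mulrn ?ltW// -powRrM mulVf// powRr1// ltW.
(* If [z <= b] the first term suffices. Otherwise [f / b = z^(n+1) / b >= z^n], whose n-th root is
   [z], and the second term suffices. *)
have [zb|bz] := leP z b.
  rewrite ler_wpDr//; first by rewrite mulr_ge0 ?powR_ge0 ?ltW.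
  by rewrite mulrC ler_wpM2r// ltW.
rewrite ler_wpDl//; first by rewrite mulr_ge0 ?ltW.
rewrite ler_wpM2l ?(ltW f0)//.
have -> : z = (z ^+ n) `^ n%:R^-1.
  by rewrite -powR_mulrn ?ltW// -powRrM mulfV ?pnatr_eq0 -?lt0n// powRr1// ltW.
rewrite ler_powR2r ?invr_ge0 ?exprn_ge0 ?(ltW z0)// ler_pdivlMr// -zf exprS mulrC.
by rewrite ler_wpM2r ?exprn_ge0 ?(ltW z0) ?(ltW bz).
Qed.

End slice_power.

Section upd.
Context {R : realType}.

(** For fixed [x] and [i] this parametrizes the line through [x] parallel to the i-th axis. *)
Definition upd n (x : 'rV[R]_n) (i : 'I_n) (s : R) : 'rV[R]_n :=
  \row_j (if j == i then s else x ord0 j).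

Lemma upd_cons0 n t (x : 'rV[R]_n) s :
  upd (cons_rV (t, x)) ord0 s = cons_rV (s, x).
Proof.
apply/rowP => j; rewrite mxE; have [k ->|->] := unliftP ord0 j.
  by rewrite /= cons_rVS cons_rVS.
by rewrite eqxx cons_rV0.
Qed.

Lemma upd_consS n t (x : 'rV[R]_n) i s :
  upd (cons_rV (t, x)) (lift ord0 i) s = cons_rV (t, upd x i s).
Proof.
apply/rowP => j; rewrite mxE; have [k ->|->] := unliftP ord0 j.
  by rewrite (inj_eq (@lift_inj _ _)) !cons_rVS /= mxE.
by rewrite !cons_rV0.
Qed.

Lemma measurable_upd n (x : 'rV[R]_n) i :
  measurable_fun setT (fun s : measurableTypeR R => upd x i s).
Proof.
apply: measurable_fun_rVP => j; under eq_fun do rewrite mxE.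
by case: (j == i); [exact: measurable_id|exact: measurable_cst].
Qed.

End upd.

Section gagliardo_nirenberg.
Context (R : realType).
Local Open Scope ereal_scope.
Notation leb := (@lebesgue_measure R).

(* g plays the role of the length of the gradient of f: along every line
   parallel to a coordinate axis, f is dominated by the integral of g. *)
Definition line_dominated n (f g : 'rV[R]_n -> R) := forall i x,
  (f x)%:E <= \int[leb]_s (g (upd x i s))%:E.

Section mass.
Context (n : nat) (f g : 'rV[R]_n.+1 -> R).
Hypotheses (mf : measurable_fun setT f) (f0 : forall x, (0 <= f x)%R).
Hypotheses (mg : measurable_fun setT g) (g0 : forall x, (0 <= g x)%R).
Hypothesis fg : line_dominated f g.

(** Domination along the first axis bounds [f] on the slice by a function of the other coordinates
    only; integrating over these gives the whole mass of [g], whatever [t] is. *)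
Lemma slice_mass t : \int[lebesgue_rV]_x (f (cons_rV (t, x)))%:E <=
  \int[lebesgue_rV]_x (g x)%:E.
Proof.
rewrite ge0_integral_cons_rV2; [|exact/measurable_EFinP|by move=> x; rewrite lee_fin].
apply: integral_monotone => x _; have := fg ord0 (cons_rV (t, x)).
by under eq_integral do rewrite upd_cons0.
Qed.

(** The Poincare inequality in L^1: the slice bound is integrated over the [t] in [[-L, L]], outside
    which the slices of [f] vanish. *)
Lemma mass_le (L : R) : (0 <= L)%R -> (forall x, ~ box L x -> f x = 0%R) ->
  \int[lebesgue_rV]_x (f x)%:E <= (2 * L)%:E * \int[lebesgue_rV]_x (g x)%:E.
Proof.
move=> L0 fL.
rewrite ge0_integral_cons_rV; [|exact/measurable_EFinP|by move=> x; rewrite lee_fin].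
rewrite -(@eq_integral_supp _ (measurableTypeR R) _ leb `[(- L)%R, L]%classic); last first.
  move=> t tL; apply: integral0_eq => x _; rewrite fL// => /box_cons[].
  by rewrite ler_norml => tL' _; apply: tL; rewrite /= in_itv.
apply: (@le_trans _ _
    (\int[leb]_(t in `[(- L)%R, L]) cst (\int[lebesgue_rV]_x (g x)%:E) t)).
  by apply: integral_monotone => t _; exact: slice_mass.
have LL : lebesgue_measure (`[(- L)%R, L]%classic : set R) = (2 * L)%:E.
  rewrite lebesgue_measure_itv/= lte_fin -EFinB opprK -mulr2n mulr_natl.
  case: ifPn => //; rewrite -leNgt => L1.
  by have -> : L = 0%R; [apply/eqP; rewrite eq_le L0 andbT; lra|rewrite mul0rn].
rewrite integral_cst// muleC; apply: lee_wpmul2r.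
  by apply: integral_ge0 => x _; rewrite lee_fin.
by rewrite -LL.
Qed.

End mass.

(** Induction on the dimension. On the slice at [t], with [b] a bound for the mass of [g] there, the
    induction hypothesis applies to [f / b] and [g / b], and [powR_slice] bounds the slice integral
    by a multiple of [b]. Integrating over [t] recovers the total mass of [g]. *)
Lemma gagliardo_nirenberg n (L : R) : (0 <= L)%R -> exists2 C : R, (0 <= C)%R &
  forall f g : 'rV[R]_n.+1 -> R,
    measurable_fun setT f -> (forall x, 0 <= f x)%R ->
    measurable_fun setT g -> (forall x, 0 <= g x)%R ->
    (forall x, ~ box L x -> f x = 0%R) -> line_dominated f g ->
    \int[lebesgue_rV]_x (g x)%:E <= 1 ->
    \int[lebesgue_rV]_x (f x `^ (1 + n.+1%:R^-1))%:E <= C%:E.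
Proof.
move=> L0; elim: n => [|n [C C0 ih]].
  exists (fine (lebesgue_rV (@box R 1 L))); first exact: fine_ge0.
  move=> f g mf f0 mg g0 fL fg g1.
  rewrite fineK ?ge0_fin_numE ?lebesgue_box//.
  (* In dimension one the slice is a single point carrying a Dirac mass, so [slice_mass] is a
     pointwise bound. *)
  have f1 x : (f x <= 1)%R.
    rewrite -lee_fin -(uncons_rVK x); case: (uncons_rV x) => t y.
    have -> : y = 0%R by apply/rowP => -[].
    apply: le_trans (le_trans (slice_mass mg g0 fg t) g1).
    rewrite [leRHS](_ : _ = \int[dirac (0%R : 'rV[R]_0)]_x (f (cons_rV (t, x)))%:E)//.
    rewrite integral_dirac// ?diracT ?mul1e//.
    by apply/measurable_EFinP; exact: (measurableT_comp mf (measurable_cons_rVr _)).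
  rewrite -[leRHS]mul1e -(integral_cst lebesgue_rV (@measurable_box _ 1 L)).
  rewrite -(@eq_integral_supp _ _ _ _ (@box R 1 L)).
    apply: integral_monotone => x _; rewrite lee_fin.
    by apply: (le_trans (ler_powR2r _ (f0 x) (f1 x))); rewrite ?powR1.
  by move=> x /fL ->; rewrite powR0// gt_eqF.
(* One contribution per term of [powR_slice]: [slice_mass] gives 1, the induction hypothesis gives
   [C]. *)
exists (1 + C)%R; first by rewrite addr_ge0.
move=> f g mf f0 mg g0 fL fg g1.
have gE0 x : 0 <= (g x)%:E by rewrite lee_fin.
have mgE : measurable_fun setT (EFin \o g) by exact/measurable_EFinP.
have slice t (b : R) : (0 < b)%R -> \int[lebesgue_rV]_x (g (cons_rV (t, x)))%:E <= b%:E ->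
    \int[lebesgue_rV]_x (f (cons_rV (t, x)) `^ (1 + n.+2%:R^-1))%:E <= ((1 + C) * b)%:E.
  move=> b0 gb.
  have mft : measurable_fun setT (fun x => f (cons_rV (t, x))).
    exact: (measurableT_comp mf (measurable_cons_rVr _)).
  have mgt : measurable_fun setT (fun x => g (cons_rV (t, x))).
    exact: (measurableT_comp mg (measurable_cons_rVr _)).
  have b0' : (0 <= b^-1)%R by rewrite invr_ge0 ltW.
  apply: (@le_trans _ _ (\int[lebesgue_rV]_x (b * f (cons_rV (t, x)) +
      b * (b^-1 * f (cons_rV (t, x))) `^ (1 + n.+1%:R^-1))%:E)).
    by apply: integral_monotone => x _; rewrite lee_fin [(b^-1 * _)%R]mulrC powR_slice.
  have mfb : measurable_fun setT
      (fun x => (b^-1 * f (cons_rV (t, x))) `^ (1 + n.+1%:R^-1))%R.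
    by apply: measurable_powR_fun => //; exact: measurable_funM.
  rewrite ge0_integralD_real//; last 4 first.
  - exact: measurable_funM.
  - exact: measurable_funM.
  - by move=> x; rewrite mulr_ge0// ltW.
  - by move=> x; rewrite mulr_ge0// ?powR_ge0// ltW.
  rewrite !ge0_integralZl_real// ?(ltW b0)//; last by move=> x; exact: powR_ge0.
  rewrite mulrDl mul1r EFinD leeD//.
    rewrite -[leRHS]mule1 lee_wpmul2l ?lee_fin ?(ltW b0)//.
    exact: le_trans (slice_mass mg g0 fg t) g1.
  rewrite mulrC EFinM lee_wpmul2l ?lee_fin ?(ltW b0)//.
  apply: (ih _ (fun x => b^-1 * g (cons_rV (t, x)))%R) => //.
  - exact: measurable_funM.
  - by move=> x; rewrite mulr_ge0.
  - exact: measurable_funM.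
  - by move=> x; rewrite mulr_ge0.
  - by move=> x xL; rewrite fL ?mulr0// => /box_cons[].
  - move=> i x; rewrite ge0_integralZl_real//; last first.
      exact: (measurableT_comp mgt (measurable_upd _ _)).
    rewrite EFinM lee_wpmul2l ?lee_fin//.
    apply: (le_trans (fg (lift ord0 i) (cons_rV (t, x)))).
    by apply: integral_monotone => s _; rewrite upd_consS.
  - by rewrite ge0_integralZl_real// lee_pdivrMl// mule1.
have mB := measurable_integral_cons_rV1 mgE gE0.
have B0 t : 0 <= \int[lebesgue_rV]_x (g (cons_rV (t, x)))%:E by exact: integral_ge0.
rewrite ge0_integral_cons_rV; last 2 first.
- by apply/measurable_EFinP; exact: measurable_powR_fun.
- by move=> x; rewrite lee_fin powR_ge0.
apply: (@le_trans _ _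
    (\int[leb]_t ((1 + C)%:E * \int[lebesgue_rV]_x (g (cons_rV (t, x)))%:E))).
  apply: integral_monotone => t _.
  (* The slice mass [r] may be 0 while [slice] asks for a positive bound, so [r + e / (1 + C)] is
     used and [e] tends to 0. An infinite mass makes the bound trivial. *)
  case: (\int[lebesgue_rV]_x (g (cons_rV (t, x)))%:E) (B0 t) (slice t) => [r| |] //.
  - rewrite lee_fin => r0 sl; apply/lee_addgt0Pr => e e0.
    have c0 : (0 < 1 + C)%R by rewrite ltr_wpDr.
    have := sl (r + e / (1 + C))%R; rewrite lee_fin mulrDr EFinD mulrCA divff ?gt_eqF// mulr1.
    rewrite EFinM; apply; first by rewrite ltr_wpDl// divr_gt0.
    by rewrite lerDl ltW// divr_gt0.
  - by move=> _ _; rewrite gt0_muley ?leey// lte_fin ltr_wpDr.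
rewrite ge0_integralZl_EFin ?addr_ge0//.
rewrite -[leRHS]mule1 lee_wpmul2l ?lee_fin ?addr_ge0//.
by rewrite -(ge0_integral_cons_rV mgE).
Qed.

End gagliardo_nirenberg.

(** * Calculus along coordinate lines *)

Section norm_power.
Context (R : realType).

(** The odd power function; [P * sgpow (P - 1)] is the derivative of [|y|^P] for [P > 1]. *)
Definition sgpow (r y : R) : R := Num.sg y * `|y| `^ r.

Lemma norm_sgpow r y : 0 < r -> `|sgpow r y| = `|y| `^ r.
Proof.
move=> r0; rewrite /sgpow normrM normr_sg ger0_norm ?powR_ge0//.
by have [->|y0] := eqVneq y 0; rewrite ?normr0 ?powR0 ?gt_eqF// ?mulr0 ?mul1r.
Qed.

Lemma sgpowN r y : sgpow r (- y) = - sgpow r y.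
Proof. by rewrite /sgpow sgrN normrN mulNr. Qed.

Lemma sgpow0 r : sgpow r 0 = 0.
Proof. by rewrite /sgpow sgr0 mul0r. Qed.

Lemma cvg_sgpow0 (r : R) : 0 < r -> sgpow r y @[y --> 0] --> 0.
Proof.
move=> r0; apply/cvgr0Pnorm_lt => e e0.
have er0 : 0 < e `^ r^-1 by rewrite powR_gt0.
near=> y; rewrite norm_sgpow//.
have : `|y| < e `^ r^-1 by near: y; exact: (cvgr0_norm_lt _ (@cvg_id _ (nbhs (0 : R)))).
move=> /(gt0_ltr_powR r0); rewrite !nnegrE => /(_ (normr_ge0 _) (ltW er0)).
by rewrite -powRrM mulVf ?gt_eqF// powRr1 ?ltW.
Unshelve. all: by end_near. Qed.

Let continuous_sgpow_gt0 r x : 0 < x -> {for x, continuous (sgpow r)}.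
Proof.
move=> x0; rewrite /prop_for /continuous_at.
have -> : sgpow r x = x `^ r by rewrite /sgpow gtr0_sg// mul1r gtr0_norm.
apply: (@cvg_trans _ (y `^ r @[y --> x])).
  apply: near_eq_cvg; near=> y; have y0 : 0 < y by near: y; exact: lt_nbhsr.
  by rewrite /sgpow gtr0_sg// mul1r gtr0_norm.
have /derivable1_diffP/differentiable_continuous : derivable (@powR R ^~ r) x 1.
  by apply: derivable_powR; rewrite in_itv/= x0.
exact.
Unshelve. all: by end_near. Qed.

Lemma continuous_sgpow r : 0 < r -> continuous (sgpow r).
Proof.
move=> r0 x; have [x0|x0|->] := ltgtP x 0; last first.
- rewrite /continuous_at /sgpow sgr0 mul0r; exact: cvg_sgpow0.
- exact: continuous_sgpow_gt0.
- rewrite /continuous_at.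
  have -> : sgpow r = fun y => - sgpow r (- y) by apply/funext => y; rewrite sgpowN opprK.
  apply: cvgN; apply: (@cvg_comp _ _ _ -%R (sgpow r) _ (nbhs (- x))).
    exact: oppr_continuous.
  by apply: continuous_sgpow_gt0; rewrite oppr_gt0.
Qed.

Let is_derive_norm_powR_gt0 (P x : R) : 0 < x ->
  is_derive x 1 (fun y : R => `|y| `^ P) (P * sgpow (P - 1) x).
Proof.
move=> x0; rewrite /sgpow gtr0_sg// mul1r gtr0_norm//.
have E : \near x, x `^ P = `|x| `^ P.
  near=> y; have y0 : 0 < y by near: y; exact: lt_nbhsr.
  by rewrite gtr0_norm.
apply: (@near_eq_is_derive _ _ _ (fun y => y `^ P) _ _ _ _ E).
exact: is_derive1_powR.
Unshelve. all: by end_near. Qed.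

Lemma is_derive_norm_powR (P x : R) : 1 < P ->
  is_derive x 1 (fun y : R => `|y| `^ P) (P * sgpow (P - 1) x).
Proof.
move=> P1; have [x0|x0|->] := ltgtP x 0; last first.
- have P10 : 0 < P - 1 by rewrite subr_gt0.
  (* At 0 the difference quotient of [|y|^P] equals [sgpow (P - 1) h], which tends to 0 because
     [P > 1]. *)
  have cv : h^-1 *: (`|(h *: (1 : R) + 0 : R)| `^ P - `|0 : R| `^ P)
      @[h --> (0 : R)^'] --> (0 : R).
    apply: (@cvg_trans _ (sgpow (P - 1) y @[y --> (0 : R)^'])); last first.
      by apply: cvg_within_filter; exact: cvg_sgpow0.
    apply: near_eq_cvg; near=> h.
    have h0 : h != 0 by near: h; exact: nbhs_dnbhs_neq.
    rewrite addr0 normr0 powR0 ?gt_eqF ?(lt_trans ltr01)// subr0.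
    rewrite /GRing.scale/= mulr1 -mulr_powRB1 ?(lt_trans ltr01)//.
    rewrite mulrA /sgpow; congr (_ * _).
    by rewrite normrEsg mulrCA mulVf ?mulr1.
  rewrite sgpow0 mulr0; split; first by apply/cvg_ex; exists 0; exact: cv.
  exact: cvg_lim cv.
- exact: is_derive_norm_powR_gt0.
(* Negative points follow by reflection, the function being even and its derivative odd. *)
- have -> : (fun y : R => `|y| `^ P) = (fun y => `|y| `^ P) \o -%R.
    by apply/funext => y /=; rewrite normrN.
  have d0 : is_derive (- x) 1 (fun y : R => `|y| `^ P) (P * sgpow (P - 1) (- x)).
    by apply: is_derive_norm_powR_gt0; rewrite oppr_gt0.
  have := @is_derive1_comp R (fun y : R => `|y| `^ P) -%R x _ _ d0 (is_deriveNid x 1).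
  by rewrite sgpowN mulrN1 mulrN opprK.
Unshelve. all: by end_near. Qed.

End norm_power.

Section lines.
Context {R : realType} (n : nat).
Implicit Types (phi : 'rV[R]_n -> R) (x : 'rV[R]_n) (i : 'I_n) (s : R).

Lemma updE x i s h : upd x i (h *: 1 + s) = h *: delta_mx ord0 i + upd x i s.
Proof.
apply/rowP => j; rewrite !mxE eqxx/=; case: eqVneq => _ /=.
  by rewrite /GRing.scale/=.
by rewrite mulr0 add0r.
Qed.

Lemma is_derive_upd phi x i s : derivable phi (upd x i s) (delta_mx ord0 i) ->
  is_derive s 1 (phi \o upd x i) (partial i phi (upd x i s)).
Proof.
rewrite /partial /derivable => dphi.
have E : (fun h => h^-1 *: ((phi \o upd x i) (h *: 1 + s) - (phi \o upd x i) s)) =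
  (fun h => h^-1 *: (phi (h *: delta_mx ord0 i + upd x i s) - phi (upd x i s))).
  by apply/funext => h /=; rewrite updE.
by split; rewrite ?/derivable ?/derive E.
Qed.

Lemma continuous_upd x i : continuous (upd x i : R -> 'rV[R]_n).
Proof.
move=> s.
have -> : upd x i = (fun r : R => r *: delta_mx ord0 i + upd x i 0).
  by apply/funext => r; rewrite -updE addr0 /GRing.scale/= mulr1.
apply: cvgD; last exact: cvg_cst.
by apply: cvgZr_tmp; exact: cvg_id.
Qed.

Lemma upd_id x i : upd x i (x ord0 i) = x.
Proof. by apply/rowP => j; rewrite mxE; case: eqVneq => [->|]. Qed.

End lines.

(** * The Euclidean norm *)

Section enorm.
Context {R : realType} (n : nat).
Implicit Types x y : 'rV[R]_n.

Lemma enorm_ge0 x : 0 <= enorm x.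
Proof. exact: sqrtr_ge0. Qed.

Lemma sqr_enorm x : enorm x ^+ 2 = \sum_i x ord0 i ^+ 2.
Proof. by rewrite sqr_sqrtr// sumr_ge0// => i _; exact: sqr_ge0. Qed.

Lemma coord_le_enorm x i : `|x ord0 i| <= enorm x.
Proof.
rewrite -sqrtr_sqr ler_sqrt ?sumr_ge0// => [|j _]; last exact: sqr_ge0.
by rewrite (bigD1 i)//= lerDl sumr_ge0// => j _; exact: sqr_ge0.
Qed.

Lemma enormZ k x : enorm (k *: x) = `|k| * enorm x.
Proof.
rewrite /enorm -sqrtr_sqr -sqrtrM ?sqr_ge0//; congr Num.sqrt.
by rewrite mulr_sumr; apply: eq_bigr => i _; rewrite mxE exprMn.
Qed.

(** A weak triangle inequality from [(a + b)^2 <= 2 (a^2 + b^2)]; the maximum is convenient because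
    powers pass through it. *)
Lemma enormD_le x y : enorm (x + y) <= 2 * Num.max (enorm x) (enorm y).
Proof.
set m := Num.max _ _; have m0 : 0 <= m by rewrite le_max enorm_ge0.
rewrite -(@ler_pXn2r _ 2)// ?nnegrE ?enorm_ge0 ?mulr_ge0//.
have xm : enorm x ^+ 2 <= m ^+ 2 by rewrite ler_pXn2r// ?nnegrE ?enorm_ge0 ?le_max ?lexx.
have ym : enorm y ^+ 2 <= m ^+ 2 by rewrite ler_pXn2r// ?nnegrE ?enorm_ge0 ?le_max ?lexx ?orbT.
rewrite exprMn; apply: (@le_trans _ _ (2 * (enorm x ^+ 2 + enorm y ^+ 2))); last by nra.
rewrite !sqr_enorm -big_split mulr_sumr/=; apply: ler_sum => i _.
rewrite mxE; have := sqr_ge0 (x ord0 i - y ord0 i); nra.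
Qed.

Lemma measurable_enorm d (T : measurableType d) (D : set T) (G : T -> 'rV[R]_n) :
  measurable D -> (forall i, measurable_fun D (fun t => G t ord0 i)) ->
  measurable_fun D (fun t => enorm (G t)).
Proof.
move=> mD mG; apply: (measurableT_comp (continuous_measurable_fun (@sqrt_continuous R))).
by apply: measurable_sum => i; exact: measurable_funX.
Qed.

End enorm.

(** * Continuously differentiable functions vanishing outside Omega *)

Section c1_functions.
Context {R : realType} (n : nat).
Implicit Types (Omega : set 'rV[R]_n) (phi : 'rV[R]_n -> R).

(** Keeps from a test function first-order regularity, vanishing outside [Omega] and boundedness;
    the last makes the integral of [|phi|^P] over a box finite. *)
Definition C1_supported Omega phi : Prop :=
  [/\ continuous phi,
      forall i x, derivable phi x (delta_mx ord0 i),
      forall i, continuous (partial i phi),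
      forall x, ~ Omega x -> phi x = 0 &
      exists M, forall x, `|phi x| <= M].

Lemma test_function_C1 Omega phi :
  test_function Omega phi -> C1_supported Omega phi.
Proof.
move=> [sphi csupp supp]; split.
- exact: (sphi [::]).1.
- by move=> i x; exact: (sphi [::]).2.
- by move=> i; exact: (sphi [:: i]).1.
- move=> x Ox; apply/eqP; apply/negPn/negP => phix.
  by apply/Ox/supp; exact: subset_closure.
- have cphi : continuous phi := (sphi [::]).1.
  have /compact_bounded [M [_ /(_ (M + 1))]] :
      compact (phi @` closure [set x | phi x != 0]).
    by apply: continuous_compact => //; exact: continuous_subspaceT.
  rewrite ltrDl => /(_ ltr01) bM; exists (Num.max 0 (M + 1)) => x.
  have [->|phix] := eqVneq (phi x) 0; first by rewrite normr0 le_max lexx.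
  rewrite le_max (bM (phi x)) ?orbT//; exists x => //.
  exact: subset_closure.
Qed.

Lemma C1_supportedZ Omega phi (k : R) :
  C1_supported Omega phi -> C1_supported Omega (fun x => k * phi x) /\
  forall x, gradient (fun x => k * phi x) x = k *: gradient phi x.
Proof.
move=> [cphi dphi cdphi phi0 [M phiM]].
have dk i : partial i (fun x => k * phi x) = fun x => k * partial i phi x.
  by apply/funext => x; exact: deriveZ.
split; last by move=> x; apply/rowP => i; rewrite !mxE dk.
split.
- by move=> x; apply: (@continuousM _ _ (cst k)); [exact: cst_continuous|exact: cphi].
- by move=> i x; exact: derivableZ.
- move=> i; rewrite dk => x.
  by apply: (@continuousM _ _ (cst k)); [exact: cst_continuous|exact: cdphi].
- by move=> x /phi0 ->; rewrite mulr0.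
- by exists (`|k| * M) => x; rewrite normrM ler_wpM2l.
Qed.

Section lines.
Context (Omega : set 'rV[R]_n) (phi : 'rV[R]_n -> R) (L P : R).
Hypotheses (L0 : 0 <= L) (OL : Omega `<=` box L) (P1 : 1 < P).
Hypothesis C1phi : C1_supported Omega phi.

(** The fundamental theorem of calculus for [|phi|^P] along the line, from a point outside the box,
    where [phi] vanishes, up to [x]. *)
Lemma line_dominated_norm_powR :
  line_dominated (fun x => `|phi x| `^ P)
    (fun x => P * (`|phi x| `^ (P - 1) * enorm (gradient phi x))).
Proof.
move=> i x; have [cphi dphi cdphi phi0 _] := C1phi.
have P0 : 0 < P by rewrite (lt_trans ltr01).
have P10 : 0 < P - 1 by rewrite subr_gt0.
have g0 y : 0 <= P * (`|phi y| `^ (P - 1) * enorm (gradient phi y)).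
  by rewrite !mulr_ge0 ?powR_ge0 ?enorm_ge0 ?ltW.
have [xL|xL] := pselect (box L x); last first.
  rewrite phi0; last by move/OL.
  by rewrite normr0 powR0 ?gt_eqF//; apply: integral_ge0 => s _; rewrite lee_fin.
(* The box is closed, so the starting coordinate is taken strictly below [-L]. *)
pose a := - (L + 1); pose b := x ord0 i.
have ab : a < b.
  by have := xL i; rewrite ler_norml /a /b => /andP[? _]; lra.
pose F := (fun y : R => `|y| `^ P) \o (phi \o upd x i).
pose F' (s : R) : R := P * sgpow (P - 1) (phi (upd x i s)) * partial i phi (upd x i s).
have dF (s : R) : is_derive s 1 F (F' s).
  apply: is_derive1_comp; last exact: is_derive_upd.
  exact: is_derive_norm_powR.
have cu : continuous (upd x i) := @continuous_upd _ _ x i.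
have cF' : continuous F'.
  move=> s; apply: (@continuousM _ _ (fun s => P * sgpow (P - 1) (phi (upd x i s)))).
    apply: (@continuousM _ _ (cst P)); first exact: cvg_cst.
    apply: (@continuous_comp _ _ _ (phi \o upd x i)); last exact: continuous_sgpow.
    by apply: continuous_comp; [exact: cu|exact: cphi].
  by apply: continuous_comp; [exact: cu|exact: cdphi].
have cF : continuous F.
  by move=> s; apply: differentiable_continuous; apply/derivable1_diffP; apply: ex_derive.
have FTC : (\int[lebesgue_measure]_(s in `[a, b]) (F' s)%:E = (F b)%:E - (F a)%:E)%E.
  apply: continuous_FTC2 => //.
  - exact: continuous_subspaceT.
  - split; first by move=> s _; exact: ex_derive.
    + exact/cvg_at_right_filter/cF.
    + exact/cvg_at_left_filter/cF.
  - by move=> s _; rewrite derive1E derive_val.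
have Fa : F a = 0.
  rewrite /F /= phi0 ?normr0 ?powR0 ?gt_eqF// => /OL /(_ i).
  rewrite mxE eqxx /a normrN ger0_norm ?addr_ge0//; lra.
have -> : `|phi x| `^ P = F b by rewrite /F /= upd_id.
have -> : (F b)%:E = (\int[lebesgue_measure]_(s in `[a, b]) (F' s)%:E)%E.
  by rewrite FTC Fa sube0.
apply: (@le_trans _ _ (\int[lebesgue_measure]_(s in `[a, b])
    (P * (`|phi (upd x i s)| `^ (P - 1) * enorm (gradient phi (upd x i s))))%:E)%E).
  apply: integral_monotone => s _; rewrite lee_fin /F' -mulrA ler_wpM2l ?(ltW P0)//.
  rewrite (le_trans (ler_norm _))// normrM norm_sgpow// ler_wpM2l ?powR_ge0//.
  by have := coord_le_enorm (gradient phi (upd x i s)) i; rewrite mxE.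
by apply: integral_monotone_mkset => s; rewrite lee_fin.
Qed.

End lines.
End c1_functions.

(** * The Sobolev inequality for compactly supported functions *)

Section poincare_sobolev.
Context {R : realType}.

(** If [b <= e a] the first term already dominates; otherwise [a <= b / e] and the second one
    does. *)
Lemma young_powR (P a b e : R) : 1 < P -> 0 <= a -> 0 <= b -> 0 < e ->
  a `^ (P - 1) * b <= e * a `^ P + e^-1 `^ (P - 1) * b `^ P.
Proof.
move=> P1 a0 b0 e0; have P0 : 0 < P by rewrite (lt_trans ltr01).
have P10 : 0 <= P - 1 by rewrite subr_ge0 ltW.
rewrite -(mulr_powRB1 a0 P0) -(mulr_powRB1 b0 P0).
have [bea|/ltW eab] := leP b (e * a).
  rewrite ler_wpDr ?mulr_ge0 ?powR_ge0//.
  by rewrite mulrA [leRHS]mulrC ler_wpM2l ?powR_ge0.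
rewrite ler_wpDl ?mulr_ge0 ?powR_ge0 ?(ltW e0)//.
rewrite mulrCA [leRHS]mulrC ler_wpM2r// -powRM ?invr_ge0 ?(ltW e0)//.
by rewrite ler_powR2r// mulrC ler_pdivlMr// mulrC.
Qed.

Variables (n : nat) (Omega : set 'rV[R]_n.+1) (L P Q : R).
Hypotheses (L0 : 0 <= L) (OL : Omega `<=` box L) (mO : measurable Omega).
Hypotheses (P1 : 1 < P) (Q0 : 0 < Q) (QP : Q / P <= 1 + n.+1%:R^-1).
Local Open Scope ereal_scope.

Let P0 : (0 < P)%R. Proof. by rewrite (lt_trans ltr01). Qed.

(** Young's inequality bounds the integral of [g] by [P e] times that of [f] plus a constant, and
    [mass_le] bounds that of [f] by [2 L] times that of [g]. For small [e] the term in [g] is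
    absorbed on the left. *)
Let c1_bound : exists2 A : R, (0 < A)%R & forall phi, C1_supported Omega phi ->
  \int[lebesgue_rV]_(x in Omega) (enorm (gradient phi x) `^ P)%:E <= 1 ->
  \int[lebesgue_rV]_x (P * (`|phi x| `^ (P - 1) * enorm (gradient phi x)))%:E <= A%:E.
Proof.
(* Chosen so that [P e (2 L) = L / (2 (L + 1)) <= 1 / 2]; writing [L + 1] avoids dividing by 0 when
   [L = 0]. *)
pose e : R := ((4 * P * (L + 1))^-1)%R.
have L1 : (0 < L + 1)%R by rewrite ltr_wpDl.
have e0 : (0 < e)%R by rewrite invr_gt0 !mulr_gt0.
pose c : R := (P * e^-1 `^ (P - 1))%R.
have c0 : (0 < c)%R by rewrite mulr_gt0// powR_gt0// invr_gt0.
exists (2 * c)%R; first by rewrite mulr_gt0.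
move=> phi C1phi; have [cphi dphi cdphi phi0 [M phiM]] := C1phi.
pose f x := (`|phi x| `^ P)%R.
(* The gradient is controlled on [Omega] only; outside it [phi], and with it [g], vanishes. *)
pose h x := (enorm (gradient phi x) `^ P * \1_Omega x)%R.
pose g x := (P * (`|phi x| `^ (P - 1) * enorm (gradient phi x)))%R.
have f0 x : (0 <= f x)%R by exact: powR_ge0.
have h0 x : (0 <= h x)%R by rewrite mulr_ge0 ?powR_ge0// indicE.
have g0 x : (0 <= g x)%R by rewrite !mulr_ge0 ?powR_ge0 ?enorm_ge0 ?(ltW P0).
have mphi : measurable_fun setT phi by exact: continuous_measurable_rV.
have mnphi : measurable_fun setT (fun x => `|phi x|%R) by exact: measurableT_comp.
have mgrad : measurable_fun setT (fun x => enorm (gradient phi x)).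
  apply: measurable_enorm => // i; under eq_fun do rewrite mxE.
  exact: continuous_measurable_rV.
have mf : measurable_fun setT f by exact: measurable_powR_fun.
have mg : measurable_fun setT g.
  by apply: measurable_funM => //; apply: measurable_funM => //; exact: measurable_powR_fun.
have mh : measurable_fun setT h.
  by apply: measurable_funM; [exact: measurable_powR_fun|exact: measurable_indic].
rewrite (_ : \int[_]_(x in _) _ = \int[lebesgue_rV]_x (h x)%:E); last first.
  rewrite integral_mkcond; apply: eq_integral => x _.
  by rewrite patchE /h indicE; case: ifP => _; rewrite ?mulr1 ?mulr0.
move=> h1.
have fL x : ~ box L x -> f x = 0%R.
  by move=> xL; rewrite /f phi0 ?normr0 ?powR0 ?gt_eqF// => /OL.
have gfh x : (g x <= P * e * f x + c * h x)%R.
  rewrite /g /c /h indicE -!mulrA -mulrDr ler_wpM2l ?(ltW P0)//.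
  have [xO|xO] := boolP (x \in Omega).
    by rewrite mulr1 young_powR// enorm_ge0.
  have phix : phi x = 0%R by apply: phi0 => /mem_set; apply/negP.
  rewrite phix normr0 powR0; last by rewrite gt_eqF// subr_gt0.
  by rewrite mul0r !mulr0 addr0 mulr_ge0// ltW.
have fg : \int[lebesgue_rV]_x (f x)%:E <= (2 * L)%:E * \int[lebesgue_rV]_x (g x)%:E.
  by apply: mass_le => //; exact: (line_dominated_norm_powR L0 OL P1 C1phi).
have gle : \int[lebesgue_rV]_x (g x)%:E <=
    (P * e)%:E * \int[lebesgue_rV]_x (f x)%:E + c%:E.
  apply: (@le_trans _ _ (\int[lebesgue_rV]_x (P * e * f x + c * h x)%:E)).
    by apply: integral_monotone => x _; rewrite lee_fin.
  rewrite ge0_integralD_real//; last 4 first.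
  - exact: measurable_funM.
  - exact: measurable_funM.
  - by move=> x; rewrite mulr_ge0// mulr_ge0// ?(ltW P0) ?(ltW e0).
  - by move=> x; rewrite mulr_ge0// (ltW c0).
  rewrite !ge0_integralZl_real// ?(ltW c0)//; last first.
    by rewrite mulr_ge0// ?(ltW P0) ?(ltW e0).
  by rewrite leeD2l// -[leRHS]mule1 lee_wpmul2l// lee_fin ltW.
(* Absorption subtracts half of the integral of [g], which is legitimate once that integral is
   finite; this follows from finiteness for [f]. *)
have ffin : \int[lebesgue_rV]_x (f x)%:E < +oo.
  rewrite -(@eq_integral_supp _ _ _ _ (@box R n.+1 L)); last by move=> x /fL ->.
  apply: (@le_lt_trans _ _ (\int[lebesgue_rV]_(x in @box R n.+1 L) cst (M `^ P)%:E x)).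
    by apply: integral_monotone => x _; rewrite lee_fin ler_powR2r// ltW.
  rewrite integral_cst; last exact: measurable_box.
  by apply: lte_mul_pinfty; rewrite ?lebesgue_box// lee_fin powR_ge0.
have If0 : 0 <= \int[lebesgue_rV]_x (f x)%:E by apply: integral_ge0 => x _; rewrite lee_fin.
have Ig0 : 0 <= \int[lebesgue_rV]_x (g x)%:E by apply: integral_ge0 => x _; rewrite lee_fin.
rewrite -[X in X <= _]/(\int[lebesgue_rV]_x (g x)%:E).
move: If0 ffin Ig0 fg gle; case: (\int[lebesgue_rV]_x (f x)%:E) => // F F0 _.
case: (\int[lebesgue_rV]_x (g x)%:E) => // G G0.
rewrite -!EFinM -EFinD !lee_fin => FG GF.
have : (P * e * F <= P * e * (2 * L * G))%R.
  by rewrite ler_wpM2l// mulr_ge0// ltW.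
have -> : (P * e * (2 * L * G) = 2^-1 * G * (L / (L + 1)))%R.
  by rewrite /e; field; rewrite !gt_eqF.
have : (2^-1 * G * (L / (L + 1)) <= 2^-1 * G)%R.
  rewrite ler_piMr// ?mulr_ge0//; rewrite ler_pdivrMr// mul1r; lra.
lra.
Qed.

(** Dividing [|phi|^P] by [A] brings the mass of [g] below 1, as [gagliardo_nirenberg] requires.
    Then [f^(Q/P) <= 1 + f^(1 + 1/d)], and the 1 integrates to at most the volume of the box. *)
Let sobolev1 : exists2 K : R, (0 < K)%R & forall phi, C1_supported Omega phi ->
  \int[lebesgue_rV]_(x in Omega) (enorm (gradient phi x) `^ P)%:E <= 1 ->
  \int[lebesgue_rV]_(x in Omega) (`|phi x| `^ Q)%:E <= K%:E.
Proof.
have [A A0 gA] := c1_bound.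
have [C C0 GN] := @gagliardo_nirenberg R n L L0.
pose V := fine (lebesgue_rV (@box R n.+1 L)).
have V0 : (0 <= V)%R by exact: fine_ge0.
exists (A `^ (Q / P) * (V + C + 1))%R.
  by rewrite mulr_gt0 ?powR_gt0// ltr_wpDl// addr_ge0.
move=> phi C1phi gradphi; have [cphi dphi cdphi phi0 _] := C1phi.
have A0' : (0 <= A^-1)%R by rewrite invr_ge0 ltW.
pose f x := (A^-1 * `|phi x| `^ P)%R.
pose g x := (A^-1 * (P * (`|phi x| `^ (P - 1) * enorm (gradient phi x))))%R.
have g0 x : (0 <= P * (`|phi x| `^ (P - 1) * enorm (gradient phi x)))%R.
  by rewrite !mulr_ge0 ?powR_ge0 ?enorm_ge0 ?(ltW P0).
have mphi : measurable_fun setT (fun x => `|phi x|%R).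
  by apply: measurableT_comp => //; exact: continuous_measurable_rV.
have mgrad : measurable_fun setT (fun x => enorm (gradient phi x)).
  apply: measurable_enorm => // i; under eq_fun do rewrite mxE.
  exact: continuous_measurable_rV.
have mg : measurable_fun setT
    (fun x => P * (`|phi x| `^ (P - 1) * enorm (gradient phi x)))%R.
  by apply: measurable_funM => //; apply: measurable_funM => //; exact: measurable_powR_fun.
have mf : measurable_fun setT f.
  by apply: measurable_funM => //; exact: measurable_powR_fun.
have f0 x : (0 <= f x)%R by rewrite mulr_ge0 ?powR_ge0.
have GNf : \int[lebesgue_rV]_x (f x `^ (1 + n.+1%:R^-1))%:E <= C%:E.
  apply: (GN f g) => //.
  - exact: measurable_funM.
  - by move=> x; rewrite mulr_ge0.
  - by move=> x xL; rewrite /f phi0 ?normr0 ?powR0 ?mulr0 ?gt_eqF// => /OL.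
  - move=> i x; rewrite /f /g ge0_integralZl_real//; last first.
      by apply: (measurableT_comp mg); exact: measurable_upd.
    rewrite EFinM lee_wpmul2l ?lee_fin//.
    exact: (line_dominated_norm_powR L0 OL P1 C1phi).
  - by rewrite /g ge0_integralZl_real// lee_pdivrMl// mule1 gA.
have mfp : measurable_fun setT (fun x => f x `^ (1 + n.+1%:R^-1))%R.
  exact: measurable_powR_fun.
have QP0 : (0 <= Q / P)%R by rewrite divr_ge0 ?ltW.
apply: (@le_trans _ _ (\int[lebesgue_rV]_(x in Omega)
    (A `^ (Q / P) * (1 + f x `^ (1 + n.+1%:R^-1)))%:E)).
  apply: integral_monotone => x _; rewrite lee_fin.
  have -> : (`|phi x| `^ Q = A `^ (Q / P) * f x `^ (Q / P))%R.
    rewrite -powRM ?(ltW A0)// /f mulrA mulfV ?gt_eqF// mul1r -powRrM.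
    by rewrite mulrCA mulfV ?mulr1// gt_eqF.
  rewrite ler_wpM2l ?powR_ge0//.
  have [f1|f1] := leP (f x) 1%R.
    apply: (@le_trans _ _ 1%R); last by rewrite lerDl powR_ge0.
    by apply: (le_trans (ler_powR2r QP0 (f0 x) f1)); rewrite powR1.
  by rewrite ler_wpDl// ler_powR// ltW.
have VO : lebesgue_rV Omega <= V%:E.
  rewrite /V fineK ?ge0_fin_numE ?lebesgue_box//.
  by apply: le_measure; rewrite ?inE//; exact: measurable_box.
rewrite ge0_integralZl_real//; last 3 first.
- by apply: measurable_funD => //; exact: measurable_funS mfp.
- by move=> x; rewrite addr_ge0 ?powR_ge0.
- exact: powR_ge0.
rewrite EFinM lee_wpmul2l ?lee_fin ?powR_ge0//.
rewrite ge0_integralD_real//; last 2 first.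
- exact: measurable_funS mfp.
- by move=> x; exact: powR_ge0.
rewrite !EFinD; apply: (@le_trans _ _ (V%:E + C%:E)); last by rewrite leeDl// lee_fin.
apply: leeD; first by rewrite integral_cst// mul1e.
apply: le_trans GNf; apply: integral_monotone_mkset => x.
by rewrite lee_fin powR_ge0.
Qed.

(** Homogeneity: the normalized case is applied to [phi / l]. *)
Lemma poincare_sobolev : exists2 K : R, (0 < K)%R & forall phi l,
  C1_supported Omega phi -> (0 < l)%R ->
  \int[lebesgue_rV]_(x in Omega) (enorm (gradient phi x) `^ P)%:E <= (l `^ P)%:E ->
  \int[lebesgue_rV]_(x in Omega) (`|phi x| `^ Q)%:E <= (K * l `^ Q)%:E.
Proof.
have [K K0 HK] := sobolev1; exists K => // phi l C1phi l0.
have [C1lphi gradE] := C1_supportedZ l^-1 C1phi.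
have [cphi dphi cdphi phi0 _] := C1phi.
have l1 : (0 <= l^-1)%R by rewrite invr_ge0 ltW.
have mgrad : measurable_fun Omega (fun x => enorm (gradient phi x)).
  apply: measurable_enorm => // i; under eq_fun do rewrite mxE.
  by apply: (measurable_funS measurableT) => //; exact: continuous_measurable_rV.
have mphi : measurable_fun Omega (fun x => `|phi x|%R).
  apply: (measurable_funS measurableT) => //.
  by apply: measurableT_comp => //; exact: continuous_measurable_rV.
have scale (r : R) (f : 'rV[R]_n.+1 -> R) (f0 : forall x, (0 <= f x)%R) :
    measurable_fun Omega f ->
    \int[lebesgue_rV]_(x in Omega) ((l^-1 * f x) `^ r)%:E =
    (l `^ r)^-1%:E * \int[lebesgue_rV]_(x in Omega) (f x `^ r)%:E.
  move=> mf; rewrite -ge0_integralZl_real//; last 3 first.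
  - exact: measurable_powR_fun.
  - by move=> x; exact: powR_ge0.
  - by rewrite invr_ge0 powR_ge0.
  apply: eq_integral => x _; rewrite powRM// -[(l^-1)%R]powR_inv1 ?(ltW l0)//.
  by rewrite -powRrM mulN1r powRN.
move=> gradl.
have EP : \int[lebesgue_rV]_(x in Omega)
      (enorm (gradient (fun y => l^-1 * phi y)%R x) `^ P)%:E =
    \int[lebesgue_rV]_(x in Omega) ((l^-1 * enorm (gradient phi x)) `^ P)%:E.
  by apply: eq_integral => x _; rewrite gradE enormZ ger0_norm.
have EQ : \int[lebesgue_rV]_(x in Omega) (`|l^-1 * phi x| `^ Q)%:E =
    \int[lebesgue_rV]_(x in Omega) ((l^-1 * `|phi x|) `^ Q)%:E.
  by apply: eq_integral => x _; rewrite normrM (ger0_norm l1).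
have := HK _ C1lphi; rewrite EP EQ !scale//; last by move=> x; exact: enorm_ge0.
rewrite !lee_pdivrMl ?powR_gt0// mule1 => /(_ gradl).
by rewrite -EFinM mulrC.
Qed.

End poincare_sobolev.

(** * Two-sided bounds for H *)

Section big_H_bounds.
Context {R : realType} (d : nat) (p q : 'rV[R]_d -> R -> R) (mu : 'rV[R]_d -> R).
Variables (x : 'rV[R]_d) (P Q M : R).
Hypotheses (P2 : (2 : R) <= P) (Q2 : (2 : R) <= Q) (mu0 : 0 <= mu x) (muM : mu x <= M).
Hypotheses (pP : forall t, 0 <= t -> P <= p x t) (pQ : forall t, 0 <= t -> p x t <= Q).
Hypotheses (q2 : forall t, 0 <= t -> 2 <= q x t) (qQ : forall t, 0 <= t -> q x t <= Q).
Notation h := (small_h p q mu x).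

Let P1 : 0 <= P - 1. Proof. by rewrite subr_ge0 (le_trans _ P2)// ler1n. Qed.
Let Q1 : 0 <= Q - 1. Proof. by rewrite subr_ge0 (le_trans _ Q2)// ler1n. Qed.
Let P0 : 0 < P. Proof. by rewrite (lt_le_trans _ P2). Qed.
Let Q0 : 0 < Q. Proof. by rewrite (lt_le_trans _ Q2). Qed.

Lemma small_hN s : h (- s) = - h s.
Proof.
rewrite /small_h normrN oppr_eq0; case: ifP => _; first by rewrite oppr0.
by rewrite !mulrN -opprD.
Qed.

Let hE s : 0 < s -> h s = s `^ (p x s - 1) + mu x * s `^ (q x s - 1).
Proof.
move=> s0; rewrite /small_h gt_eqF// gtr0_norm// -mulrA.
have E r : 2 <= r -> s `^ (r - 2) * s = s `^ (r - 1).
  move=> r2; have r1 : 0 < r - 1 by lra.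
  rewrite -(mulr_powRB1 (ltW s0) r1) mulrC.
  by have -> : r - 2 = r - 1 - 1 by lra.
by rewrite !E ?q2 ?(ltW s0)// (le_trans P2)// pP// ltW.
Qed.

Lemma small_h_ge0 s : 0 <= s -> 0 <= h s.
Proof.
rewrite le_eqVlt => /predU1P[<-|s0]; first by rewrite /small_h eqxx.
by rewrite hE// addr_ge0 ?mulr_ge0 ?powR_ge0.
Qed.

Lemma small_h_ge s : 1 <= s -> s `^ (P - 1) <= h s.
Proof.
move=> s1; have s0 : 0 < s by rewrite (lt_le_trans ltr01).
rewrite hE// ler_wpDr ?mulr_ge0 ?powR_ge0//.
by rewrite ler_powR// lerB// pP// ltW.
Qed.

Let powR_le_add s r : 0 < s -> 2 <= r <= Q -> s `^ (r - 1) <= s + s `^ (Q - 1).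
Proof.
move=> s0 /andP[r2 rQ]; have [s1|s1] := leP s 1.
  rewrite ler_wpDr ?powR_ge0// -[leRHS]powRr1 ?(ltW s0)//.
  by apply: ger_powR; rewrite ?s0//; lra.
by rewrite ler_wpDl ?(ltW s0)// ler_powR ?(ltW s1)// lerB.
Qed.

Lemma small_h_le s : 0 <= s -> h s <= (1 + M) * (s + s `^ (Q - 1)).
Proof.
have M0 : 0 <= M by exact: le_trans muM.
rewrite le_eqVlt => /predU1P[<-|s0].
  by rewrite /small_h eqxx mulr_ge0 ?addr_ge0 ?powR_ge0.
rewrite hE// mulrDl mul1r lerD//.
  by rewrite powR_le_add// pQ ?(ltW s0)// andbT (le_trans P2)// pP// ltW.
by rewrite ler_pM ?powR_ge0// powR_le_add// q2 ?qQ ?(ltW s0).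
Qed.

(** The interval between 0 and [t] without orientation. *)
Let itv (t : R) : set R := if 0 <= t then `[0, t]%classic else `[t, 0]%classic.

Let itv_norm t s : itv t s -> `|s| <= `|t|.
Proof.
rewrite /itv; case: ifPn => [t0|]; rewrite /= in_itv/=.
  by move=> /andP[s0 st]; rewrite !ger0_norm.
rewrite -ltNge => t0 /andP[ts s0]; rewrite ler0_norm// ltr0_norm//; lra.
Qed.

(** Since [small_h] is odd, [big_H] is even, and both signs of [t] reduce to one nonnegative
    integrand. *)
Let big_HE t :
  big_H p q mu x t = fine (\int[lebesgue_measure]_(s in itv t) (h `|s|)%:E)%E.
Proof.
rewrite /big_H /itv; case: ifPn => [t0|].
  congr fine; apply: eq_integral => s; rewrite inE/= in_itv/= => /andP[s0 _].
  by rewrite ger0_norm.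
rewrite -ltNge => t0; rewrite /Rintegral -fineN.
congr fine; suff -> : (\int[lebesgue_measure]_(s in `[t, 0%R]) (h s)%:E =
    - \int[lebesgue_measure]_(s in `[t, 0%R]) (h `|s|)%:E)%E by rewrite oppeK.
rewrite -integral_ge0N; last by move=> s _; rewrite lee_fin small_h_ge0.
apply: eq_integral => s; rewrite inE/= in_itv/= => /andP[_ s0].
by rewrite ler0_norm// small_hN opprK.
Qed.

Let itv_measure t : (lebesgue_measure (itv t) = `|t|%:E)%E.
Proof.
rewrite /itv; case: ifPn => [t0|]; rewrite lebesgue_measure_itv/= lte_fin.
  rewrite ger0_norm// oppr0 adde0; case: ltP => // t1.
  by congr EFin; apply/eqP; rewrite eq_le t0 t1.
by rewrite -ltNge => t0; rewrite t0 ltr0_norm// -EFinB sub0r.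
Qed.

(** The integrand is at most its upper bound at [|t|], and the interval has length [|t|]. *)
Let integral_h_le t : (\int[lebesgue_measure]_(s in itv t) (h `|s|)%:E <=
  ((1 + M) * (`|t| ^+ 2 + `|t| `^ Q))%:E)%E.
Proof.
have M0 : 0 <= M by exact: le_trans muM.
apply: (@le_trans _ _ (\int[lebesgue_measure]_(s in itv t)
    cst ((1 + M) * (`|t| + `|t| `^ (Q - 1)))%:E s)%E).
  apply: integral_monotone => s /itv_norm st; rewrite lee_fin.
  rewrite (le_trans (small_h_le (normr_ge0 _)))// ler_wpM2l ?addr_ge0// lerD//.
  exact: ler_powR2r.
rewrite integral_cst; last by rewrite /itv; case: ifP.
rewrite [X in (_ * X)%E]itv_measure -EFinM lee_fin -mulrA [X in _ * X <= _]mulrDl -expr2.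
by rewrite [_ `^ _ * _]mulrC mulr_powRB1.
Qed.

Let integral_h_ge0 t : (0 <= \int[lebesgue_measure]_(s in itv t) (h `|s|)%:E)%E.
Proof. by apply: integral_ge0 => s _; rewrite lee_fin small_h_ge0. Qed.

Let integral_h_fin t : (\int[lebesgue_measure]_(s in itv t) (h `|s|)%:E)%E \is a fin_num.
Proof. by rewrite ge0_fin_numE// (le_lt_trans (integral_h_le t))// ltry. Qed.

Lemma big_H_ge0 t : 0 <= big_H p q mu x t.
Proof. by rewrite big_HE fine_ge0. Qed.

Lemma big_H_le t : big_H p q mu x t <= (1 + M) * (`|t| ^+ 2 + `|t| `^ Q).
Proof. by rewrite big_HE -lee_fin fineK. Qed.

(** For [|t| < 2] the left side is at most 1. Otherwise only the half of the interval between
    [t / 2] and [t] is kept: there [|s| >= 1], the integrand is at least [(|t| / 2)^(P - 1)], and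
    the length is [|t| / 2]. *)
Lemma big_H_ge t : (`|t| / 2) `^ P <= 1 + big_H p q mu x t.
Proof.
have [t2|t2] := ltP `|t| 2.
  rewrite ler_wpDr ?big_H_ge0//.
  have t1 : `|t| / 2 <= 1 by lra.
  by rewrite (le_trans (ler_powR2r (ltW P0) _ t1)) ?powR1// divr_ge0.
rewrite ler_wpDl// big_HE -lee_fin fineK//.
pose J : set R := if 0 <= t then `[t / 2, t]%classic else `[t, t / 2]%classic.
have mJ : measurable J by rewrite /J; case: ifP.
have JP s : J s -> itv t s /\ `|t| / 2 <= `|s|.
  rewrite /J /itv; case: ifPn => [t0|]; rewrite /= !in_itv/=.
    move=> /andP[ts st]; rewrite !ger0_norm//; last by lra.
    by split; [apply/andP; split|]; lra.
  rewrite -ltNge => t0 /andP[ts st]; rewrite ltr0_norm// ltr0_norm; last by lra.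
  by split; [apply/andP; split|]; lra.
have leJ : (lebesgue_measure J = (`|t| / 2)%:E)%E.
  rewrite /J; case: ifPn => [t0|]; rewrite lebesgue_measure_itv/= lte_fin.
    rewrite ger0_norm// in t2 *; rewrite ifT; last by lra.
    by rewrite -EFinB; congr EFin; lra.
  rewrite -ltNge => t0; rewrite ltr0_norm// in t2 *; rewrite ifT; last by lra.
  by rewrite -EFinB; congr EFin; lra.
apply: (@le_trans _ _ (\int[lebesgue_measure]_(s in J) cst ((`|t| / 2) `^ (P - 1))%:E s)%E).
  have t0 : 0 <= `|t| / 2 by rewrite divr_ge0.
  by rewrite integral_cst// [X in (_ * X)%E]leJ -EFinM lee_fin [leRHS]mulrC mulr_powRB1.
rewrite integral_mkcond [leRHS]integral_mkcond; apply: integral_monotone => s _.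
rewrite !patchE; case: ifPn => [/set_mem/JP[sI ts]|_].
  rewrite mem_set// lee_fin (le_trans _ (@small_h_ge `|s| _))//; last by lra.
  by rewrite ler_powR2r ?divr_ge0.
by case: ifP => // _; rewrite lee_fin small_h_ge0.
Qed.

End big_H_bounds.

(** * Essential bounds of the exponents *)

Section almost_every_section.
Context (R : realType) d1 d2 (T1 : measurableType d1) (T2 : measurableType d2).
Variables (m1 : {sigma_finite_measure set T1 -> \bar R})
  (m2 : {sigma_finite_measure set T2 -> \bar R}).
Local Open Scope ereal_scope.

(** The product measure of a null set is the integral of the measures of its sections, which
    therefore vanish almost everywhere. *)
Lemma ae_product_section (A : T1 * T2 -> Prop) :
  {ae m1 \x m2, forall z, A z} ->
  {ae m1, forall x, {ae m2, forall y, A (x, y)}}.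
Proof.
move=> [N [mN N0 subN]].
have mx : measurable_fun setT (m2 \o xsection N) by exact: measurable_fun_xsection.
have /(ae_eq_integral_abs _ measurableT mx) :
    \int[m1]_x `|(m2 \o xsection N) x| = 0.
  by under eq_integral do rewrite gee0_abs//.
apply: filterS => x /(_ Logic.I) /= mx0.
exists (xsection N x); split => //; first exact: measurable_xsection.
by move=> y /= Axy; rewrite /xsection/= inE; apply: subN.
Qed.

End almost_every_section.

Section exponents.
Context {R : realType}.

Lemma ae_itv_exists (A : R -> Prop) (a b : R) : a < b ->
  {ae lebesgue_measure, forall t : measurableTypeR R, A t} -> exists2 t, a < t < b & A t.
Proof.
move=> ab [N [mN N0 subN]]; apply: contrapT => abA.
have : (lebesgue_measure `]a, b[%classic <= lebesgue_measure N)%E.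
  apply: le_measure; rewrite ?inE// => t /=; rewrite in_itv/= => tab.
  by apply: subN => /= At; apply: abA; exists t.
rewrite [X in (_ <= X)%E]N0 lebesgue_measure_itv/= lte_fin ab -EFinB lee_fin; lra.
Qed.

(** One good point in [(0, 1)] gives the bound on all of [[0, 1]], where [r] is constant, and
    monotonicity carries it further. *)
Lemma exponent_growth_ge (r : R -> R) P : exponent_growth r ->
  {ae lebesgue_measure, forall t : measurableTypeR R, 0 <= t -> P <= r t} ->
  forall t, 0 <= t -> P <= r t.
Proof.
move=> [_ [c rc] rmono] /(ae_itv_exists ltr01)[s /andP[s0 s1] Ps] t t0.
have Pc : P <= c by rewrite -(rc s) ?Ps ?(ltW s0) ?(ltW s1).
have [t1|t1] := leP t 1; first by rewrite rc ?t0.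
apply: (@le_trans _ _ (r 1)); first by rewrite rc ?ler01 ?lexx.
by apply: rmono => //; exact: ltW.
Qed.

(** A good point slightly to the right of [s >= 1] bounds [r s] by monotonicity; on [[0, 1]] the
    value is [r 1]. *)
Lemma exponent_growth_le (r : R -> R) Q : exponent_growth r ->
  {ae lebesgue_measure, forall t : measurableTypeR R, 0 <= t -> r t <= Q} ->
  forall t, 0 <= t -> r t <= Q.
Proof.
move=> [_ [c rc] rmono] rQ t t0.
have bounded s : 1 <= s -> r s <= Q.
  move=> s1; have ss : s < s + 1 by rewrite ltrDl.
  have [u /andP[su _] uQ] := ae_itv_exists ss rQ.
  have u1 : 1 <= u by rewrite (le_trans s1)// ltW.
  by apply: (le_trans (rmono _ _ s1 (ltW su))); apply: uQ; rewrite (le_trans ler01).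
have [t1|t1] := leP t 1; last by apply: bounded; exact: ltW.
by rewrite rc ?t0// -(rc 1) ?ler01 ?lexx// bounded.
Qed.

Variables (d : nat) (Omega : set 'rV[R]_d).
Implicit Types p : 'rV[R]_d -> R -> R.

(** The essential bound on the product holds, for almost every [x], at almost every [t]; the growth
    condition extends it to every [t]. *)
Lemma exponent_inf_ae p (P : R) : (P%:E <= exponent_inf Omega p)%E ->
  {ae lebesgue_rV, forall x, Omega x -> exponent_growth (p x)} ->
  {ae lebesgue_rV, forall x, Omega x -> forall t, 0 <= t -> P <= p x t}.
Proof.
move=> /ess_infP/(@ae_product_section R _ _ _ _ lebesgue_rV lebesgue_measure) H1 H2.
apply: filterS2 H1 H2 => x H1x H2x Ox; apply: exponent_growth_ge; first exact: H2x.
apply: filterS H1x => t; rewrite /patch; case: ifPn => [_|/negP xt] /=.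
  by rewrite lee_fin.
by move=> _ t0; exfalso; apply: xt; rewrite inE; split => //=; rewrite in_itv/= t0.
Qed.

Lemma exponent_sup_ae p (Q : R) : (exponent_sup Omega p <= Q%:E)%E ->
  {ae lebesgue_rV, forall x, Omega x -> exponent_growth (p x)} ->
  {ae lebesgue_rV, forall x, Omega x -> forall t, 0 <= t -> p x t <= Q}.
Proof.
move=> /ess_supP/(@ae_product_section R _ _ _ _ lebesgue_rV lebesgue_measure) H1 H2.
apply: filterS2 H1 H2 => x H1x H2x Ox; apply: exponent_growth_le; first exact: H2x.
apply: filterS H1x => t; rewrite /patch; case: ifPn => [_|/negP xt] /=.
  by rewrite lee_fin.
by move=> _ t0; exfalso; apply: xt; rewrite inE; split => //=; rewrite in_itv/= t0.
Qed.

Lemma ess_sup_norm_ae (f : 'rV[R]_d -> R) :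
  (ess_sup_on lebesgue_rV Omega (fun x => `|f x|%R) < +oo)%E ->
  exists M : R, {ae lebesgue_rV, forall x, Omega x -> f x <= M}.
Proof.
move=> f_fin.
have [M fM] : exists M : R, (ess_sup_on lebesgue_rV Omega (fun x => `|f x|%R) <= M%:E)%E.
  move: f_fin; case: (ess_sup_on _ _ _) => [r| |] // _; first by exists r.
  by exists 0; rewrite leNye.
exists M; move/ess_supP : fM; apply: filterS => x + Ox.
by rewrite /patch mem_set//= lee_fin; apply: le_trans; rewrite ler_norm.
Qed.

End exponents.

(** * From test functions to the closure *)

Section pointwise.
Context {R : realType}.
Implicit Types a b c m P Q : R.

Lemma powR_max2_le P a b c : 0 <= P -> 0 <= a -> 0 <= b -> 0 <= c ->
  c <= 2 * Num.max a b -> c `^ P <= 2 `^ P * (a `^ P + b `^ P).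
Proof.
move=> P0 a0 b0 c0 cab; apply: (le_trans (ler_powR2r P0 c0 cab)).
have m0 : 0 <= Num.max a b by rewrite le_max a0.
rewrite powRM// ler_wpM2l ?powR_ge0//; case: (leP a b) => _.
  by rewrite lerDr powR_ge0.
by rewrite lerDl powR_ge0.
Qed.

(** If [b <= a] then [c <= 2 a]. Otherwise the truncation of [c] is at most twice [min(b, m)], whose
    Q-th power splits into at most [m^(Q - P)] times [b^P]. *)
Lemma powR_trunc_le P Q a b c m : 0 < P -> P <= Q -> 0 <= a -> 0 <= b -> 0 <= c ->
  0 < m -> c <= a + b ->
  (Num.min c m) `^ Q <= 2 `^ Q * (a `^ Q + m `^ (Q - P) * b `^ P).
Proof.
move=> P0 PQ a0 b0 c0 m0 cab; have Q0 : 0 < Q by exact: lt_le_trans PQ.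
have cm0 : 0 <= Num.min c m by rewrite le_min c0 ltW.
have [ba|/ltW ab] := leP b a.
  apply: (@le_trans _ _ ((2 * a) `^ Q)).
    by rewrite ler_powR2r ?(ltW Q0)// ge_min; apply/orP; left; lra.
  by rewrite powRM// ler_wpM2l ?powR_ge0// lerDl mulr_ge0 ?powR_ge0.
have bm0 : 0 <= Num.min b m by rewrite le_min b0 ltW.
apply: (@le_trans _ _ ((2 * Num.min b m) `^ Q)).
  rewrite ler_powR2r ?(ltW Q0)//; case: (leP b m) => bm.
    by rewrite ge_min; apply/orP; left; lra.
  by rewrite ge_min; apply/orP; right; lra.
rewrite powRM// ler_wpM2l ?powR_ge0// ler_wpDl ?powR_ge0//.
have [->|mb0] := eqVneq (Num.min b m) 0.
  by rewrite powR0 ?gt_eqF// mulr_ge0 ?powR_ge0.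
have -> : Q = (Q - P) + P by rewrite subrK.
rewrite powRD ?mb0 ?implybT// addrK ler_pM ?powR_ge0//.
  by rewrite ler_powR2r ?subr_ge0// ge_min lexx orbT.
by rewrite ler_powR2r ?(ltW P0)// ge_min lexx.
Qed.

Lemma sqr_le_powR Q y : 2 <= Q -> 0 <= y -> y ^+ 2 <= 1 + y `^ Q.
Proof.
move=> Q2 y0; have [y1|/ltW y1] := leP y 1.
  by rewrite ler_wpDr ?powR_ge0// expr_le1.
by rewrite ler_wpDl// -powR_mulrn// ler_powR.
Qed.

End pointwise.

(** * From the modular to integrals of powers and back *)

Section modular.
Context {R : realType} (n : nat) (p q : 'rV[R]_n.+1 -> R -> R)
  (mu : 'rV[R]_n.+1 -> R) (Omega : set 'rV[R]_n.+1) (L P Q M : R).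
Hypotheses (L0 : 0 <= L) (OL : Omega `<=` box L) (oO : open Omega).
Hypotheses (P2 : (2 : R) <= P) (PQ : P <= Q) (M0 : 0 <= M).
Hypothesis QP : Q / P <= 1 + n.+1%:R^-1.
Hypothesis H_ae : {ae lebesgue_rV, forall x, Omega x -> forall t,
  [/\ 0 <= big_H p q mu x t, (`|t| / 2) `^ P <= 1 + big_H p q mu x t &
      big_H p q mu x t <= (1 + M) * (`|t| ^+ 2 + `|t| `^ Q)]}.
Local Open Scope ereal_scope.

Let P0 : (0 < P)%R. Proof. by rewrite (lt_le_trans _ P2). Qed.
Let P1 : (1 < P)%R. Proof. by rewrite (lt_le_trans _ P2)// ltr1n. Qed.
Let Q0 : (0 < Q)%R. Proof. exact: lt_le_trans PQ. Qed.
Let Q2 : ((2 : R) <= Q)%R. Proof. exact: le_trans PQ. Qed.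
Let mO : measurable Omega. Proof. exact: open_measurable_rV. Qed.

Let V := fine (lebesgue_rV Omega).

Let V0 : (0 <= V)%R. Proof. exact: fine_ge0. Qed.

Let VE : lebesgue_rV Omega = V%:E.
Proof.
rewrite fineK// ge0_fin_numE//; apply: le_lt_trans (@lebesgue_box R n.+1 L).
by apply: le_measure; rewrite ?inE//; exact: measurable_box.
Qed.

Let c1 : R := (2 `^ P * (V + 1))%R.

Let c10 : (0 <= c1)%R. Proof. by rewrite mulr_ge0 ?powR_ge0 ?addr_ge0. Qed.

(** The lower bound on [big_H] is integrated. The Borel function [w] stands in for [v], which need
    only agree with it almost everywhere. *)
Lemma rho_H_le1_powR (v w : 'rV[R]_n.+1 -> R) (l : R) :
  {ae lebesgue_rV, forall x, Omega x -> v x = w x} ->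
  measurable_fun Omega w -> (0 < l)%R ->
  rho_H p q mu Omega (fun x => v x / l)%R <= 1 ->
  \int[lebesgue_rV]_(x in Omega) (`|w x| `^ P)%:E <= (c1 * l `^ P)%:E.
Proof.
move=> vw mw l0 rho1.
pose f x := Num.max 0%R ((`|w x / l| / 2) `^ P - 1)%R.
have f0 x : (0 <= f x)%R by rewrite /f le_max lexx.
have mwl : measurable_fun Omega (fun x => `|w x / l| / 2)%R.
  by apply: measurable_funM => //; apply: measurableT_comp => //; exact: measurable_funM.
have mf : measurable_fun Omega f.
  apply: measurable_maxr => //; apply: measurable_funB => //.
  exact: measurable_powR_fun.
have f1 : \int[lebesgue_rV]_(x in Omega) (f x)%:E <= 1.
  apply: le_trans rho1; apply: integral_monotone_ae.
  apply: filterS2 vw H_ae => x vwx Hx Ox; rewrite vwx// lee_fin /f ge_max.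
  have [H0 HP _] := Hx Ox (w x / l)%R.
  by rewrite H0/= lerBlDl.
apply: (@le_trans _ _ (\int[lebesgue_rV]_(x in Omega) ((2 * l) `^ P * (1 + f x))%:E)).
  apply: integral_monotone => x _; rewrite lee_fin.
  have -> : (`|w x| = (2 * l) * (`|w x / l| / 2))%R.
    by rewrite normrM normfV (gtr0_norm l0); field; rewrite gt_eqF.
  rewrite powRM ?divr_ge0 ?mulr_ge0 ?(ltW l0)// ler_wpM2l ?powR_ge0//.
  by rewrite -lerBlDl /f le_max lexx orbT.
rewrite ge0_integralZl_real//; last 3 first.
- exact: measurable_funD.
- by move=> x; rewrite addr_ge0.
- exact: powR_ge0.
rewrite powRM ?(ltW l0)// /c1 mulrAC [leRHS]EFinM.
rewrite lee_wpmul2l ?lee_fin ?mulr_ge0 ?powR_ge0//.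
rewrite ge0_integralD_real// EFinD leeD//.
by rewrite integral_cst// mul1e -VE.
Qed.

(** As [k >= 1], both [k^-2] and [k^-Q] are at most [k^-1], so dividing by [k] gains a factor [k^-1]
    in the upper bound for [big_H]. What remains is at most [(1 + M) (V + 2 S) <= k]. *)
Lemma powR_rho_H_le1 S : (0 <= S)%R -> exists2 k : R, (0 < k)%R &
  forall (v w : 'rV[R]_n.+1 -> R) (l : R),
  {ae lebesgue_rV, forall x, Omega x -> v x = w x} ->
  measurable_fun Omega w -> (0 < l)%R ->
  \int[lebesgue_rV]_(x in Omega) (`|w x| `^ Q)%:E <= (S * l `^ Q)%:E ->
  rho_H p q mu Omega (fun x => v x / (k * l))%R <= 1.
Proof.
move=> S0; pose k : R := (1 + (1 + M) * (V + 2 * S))%R.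
have k1 : (1 <= k)%R by rewrite lerDl mulr_ge0 ?addr_ge0 ?mulr_ge0.
have k0 : (0 < k)%R by rewrite (lt_le_trans _ k1).
exists k => // v w l vw mw l0 wS.
have mwp : measurable_fun Omega (fun x => `|w x| `^ Q)%R.
  by apply: measurable_powR_fun; exact: measurableT_comp.
apply: (@le_trans _ _ (\int[lebesgue_rV]_(x in Omega)
   ((1 + M) / k * (1 + 2 / l `^ Q * `|w x| `^ Q))%:E)).
  apply: integral_monotone_ae; apply: filterS2 vw H_ae => x vwx Hx Ox.
  rewrite vwx// lee_fin; have [_ _ /le_trans] := Hx Ox (w x / (k * l))%R; apply.
  rewrite -[leRHS]mulrA ler_wpM2l ?addr_ge0//.
  set y := (`|w x| / l)%R; have y0 : (0 <= y)%R by rewrite divr_ge0// ltW.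
  have -> : (`|w x / (k * l)| = k^-1 * y)%R.
    by rewrite /y normrM normfV (gtr0_norm (mulr_gt0 k0 l0)) invfM mulrCA mulrA.
  have -> : (2 / l `^ Q * `|w x| `^ Q = 2 * y `^ Q)%R.
    rewrite /y powRM ?invr_ge0 ?(ltW l0)// -[(l^-1)%R]powR_inv1 ?(ltW l0)//.
    by rewrite -powRrM mulN1r powRN; ring.
  have ki0 : (0 < k^-1)%R by rewrite invr_gt0.
  have ki1 : (k^-1 <= 1)%R by rewrite invf_le1.
  apply: (@le_trans _ _ (k^-1 * (y ^+ 2 + y `^ Q))%R).
    rewrite mulrDr lerD//.
      rewrite exprMn ler_wpM2r ?sqr_ge0// expr2.
      by rewrite ler_piMr// ltW.
    rewrite powRM ?(ltW ki0)// ler_wpM2r ?powR_ge0//.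
    by apply: ge1r_powR; rewrite ?ki0// (le_trans _ Q2)// ler1n.
  rewrite ler_wpM2l ?(ltW ki0)//.
  have := sqr_le_powR Q2 y0; lra.
rewrite ge0_integralZl_real//; last 3 first.
- by apply: measurable_funD => //; exact: measurable_funM.
- by move=> x; rewrite addr_ge0// mulr_ge0 ?powR_ge0// divr_ge0 ?powR_ge0.
- by rewrite divr_ge0 ?(ltW k0)// addr_ge0.
rewrite ge0_integralD_real//; last 2 first.
- exact: measurable_funM.
- by move=> x; rewrite mulr_ge0 ?powR_ge0// divr_ge0 ?powR_ge0.
rewrite ge0_integralZl_real//; last by rewrite divr_ge0 ?powR_ge0.
apply: (@le_trans _ _ (((1 + M) / k)%:E * (V%:E + (2 * S)%:E))).
  apply: lee_wpmul2l; first by rewrite lee_fin divr_ge0 ?(ltW k0)// addr_ge0.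
  apply: leeD; first by rewrite integral_cst// mul1e -VE.
  apply: (@le_trans _ _ ((2 / l `^ Q)%:E * (S * l `^ Q)%:E)).
    by apply: lee_wpmul2l => //; rewrite lee_fin divr_ge0 ?powR_ge0.
  rewrite -EFinM lee_fin mulrACA mulVf ?mulr1// gt_eqF// powR_gt0//.
rewrite -EFinD -EFinM lee_fin mulrAC ler_pdivrMr// mul1r.
by rewrite /k lerDr.
Qed.

Lemma LH_norm_lt v (e : R) : LH_norm p q mu Omega v < e%:E ->
  exists2 l : R, (0 < l < e)%R & rho_H p q mu Omega (fun x => v x / l)%R <= 1.
Proof.
move=> /ereal_inf_lt[_ [l [l0 lrho] <-]]; rewrite lte_fin => le.
by exists l => //; rewrite l0.
Qed.

Lemma LH_norm_ge0 v : 0 <= LH_norm p q mu Omega v.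
Proof. by apply: le_ereal_inf_tmp => _ [l [l0 _] <-]; rewrite lee_fin ltW. Qed.

Lemma LH_norm_le v (l : R) : (0 < l)%R ->
  rho_H p q mu Omega (fun x => v x / l)%R <= 1 -> LH_norm p q mu Omega v <= l%:E.
Proof. by move=> l0 rho1; apply: ereal_inf_lbound; exists l. Qed.

End modular.

(** * Removing a truncation by monotone convergence *)

Section truncation_limit.
Context d (T : measurableType d) (R : realType).
Variable m : {measure set T -> \bar R}.

Lemma integral_powR_trunc_le (D : set T) (w : T -> R) (Q : R) (B : \bar R) :
  measurable D -> measurable_fun D w -> (forall x, 0 <= w x) -> 0 <= Q ->
  (forall k : nat, \int[m]_(x in D) (Num.min (w x) k.+1%:R `^ Q)%:E <= B)%E ->
  (\int[m]_(x in D) (w x `^ Q)%:E <= B)%E.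
Proof.
move=> mD mw w0 Q0 wB.
pose g k x : \bar R := (Num.min (w x) k.+1%:R `^ Q)%:E.
have gE x : g ^~ x @ \oo --> (w x `^ Q)%:E.
  apply: cvg_near_cst; near=> k; rewrite /g min_l//.
  have : w x <= k%:R.
    by near: k; exact: nbhs_infty_ger.
  by move=> /le_trans; apply; rewrite ler_nat.
have -> : (\int[m]_(x in D) (w x `^ Q)%:E = \int[m]_(x in D) limn (g ^~ x))%E.
  by apply: eq_integral => x _; apply/esym/cvg_lim => //; exact: gE.
have mg k : measurable_fun D (g k).
  apply/measurable_EFinP; apply: measurable_powR_fun.
  by apply: measurable_minr.
have g0 k x : D x -> (0 <= g k x)%E by rewrite lee_fin powR_ge0.
have gnd x : D x -> {homo g ^~ x : a b / (a <= b)%N >-> (a <= b)%E}.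
  move=> _ a b ab; rewrite lee_fin ler_powR2r//.
    by rewrite le_min w0 ler0n.
  by rewrite le_min !ge_min lexx/= ler_nat ltnS ab orbT.
rewrite monotone_convergence//; apply: lime_le.
  apply: ereal_nondecreasing_is_cvgn => a b ab; apply: integral_monotone => x Dx.
  exact: gnd.
by apply: nearW => k; exact: wB.
Unshelve. all: by end_near. Qed.

End truncation_limit.

(** * The inequality on the closure of the test functions *)

Section poincare.
Context {R : realType} (n : nat) (p q : 'rV[R]_n.+1 -> R -> R)
  (mu : 'rV[R]_n.+1 -> R) (Omega : set 'rV[R]_n.+1) (L P Q M : R).
Hypotheses (L0 : 0 <= L) (OL : Omega `<=` box L) (oO : open Omega).
Hypotheses (P2 : (2 : R) <= P) (PQ : P <= Q) (M0 : 0 <= M).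
Hypothesis QP : Q / P <= 1 + n.+1%:R^-1.
Hypothesis H_ae : {ae lebesgue_rV, forall x, Omega x -> forall t,
  [/\ 0 <= big_H p q mu x t, (`|t| / 2) `^ P <= 1 + big_H p q mu x t &
      big_H p q mu x t <= (1 + M) * (`|t| ^+ 2 + `|t| `^ Q)]}.
Local Open Scope ereal_scope.

Let P0 : (0 < P)%R. Proof. by rewrite (lt_le_trans _ P2). Qed.
Let P1 : (1 < P)%R. Proof. by rewrite (lt_le_trans _ P2)// ltr1n. Qed.
Let Q0 : (0 < Q)%R. Proof. exact: lt_le_trans PQ. Qed.
Let mO : measurable Omega. Proof. exact: open_measurable_rV. Qed.

(** Each truncation of [|u0|] is compared with a test function [phi] whose Q-integral is bounded
    independently of the truncation level. The error depends on the level, but [phi] is chosen after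
    it. *)
Lemma integral_powR_W01H : exists2 S : R, (0 <= S)%R & forall u G u0 l,
  in_W01H p q mu Omega u G -> measurable_fun Omega u0 ->
  {ae lebesgue_rV, forall x, Omega x -> u x = u0 x} -> (0 < l)%R ->
  rho_H p q mu Omega (fun x => enorm (G x) / l)%R <= 1 ->
  \int[lebesgue_rV]_(x in Omega) (`|u0 x| `^ Q)%:E <= (S * l `^ Q)%:E.
Proof.
have [K K0 sobolev] := poincare_sobolev L0 OL mO P1 Q0 QP.
have rho1 := rho_H_le1_powR OL oO H_ae.
set c1 : R := (2 `^ P * (fine (lebesgue_rV Omega) + 1))%R in rho1.
have c10 : (0 <= c1)%R by rewrite mulr_ge0 ?powR_ge0 ?addr_ge0 ?fine_ge0.
(* Since [c2 >= 1], also [c2 <= c2^P], so the P-integral of the gradient of [phi] will be at most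
   [(c2 l)^P]. *)
pose c2 : R := (1 + 2 `^ P * (c1 + c1))%R.
have c21 : (1 <= c2)%R by rewrite lerDl mulr_ge0 ?powR_ge0 ?addr_ge0.
exists (2 `^ Q * (K * c2 `^ Q))%R; first by rewrite !mulr_ge0 ?powR_ge0// ltW.
move=> u G u0 l [[_ [_ mG _] _] approx] mu0 uu0 l0 Gl.
(* The weak gradient is measurable only for the completed sigma-algebra, so its coordinates are
   replaced by Borel representatives. *)
have [g mg Gg] : exists2 g : 'I_n.+1 -> 'rV[R]_n.+1 -> R,
    forall i, measurable_fun Omega (g i) &
    forall i, {ae lebesgue_rV, forall x, Omega x -> G x ord0 i = g i x}.
  have ex i : exists gi : 'rV[R]_n.+1 -> R, measurable_fun Omega gi /\
      {ae lebesgue_rV, forall x, Omega x -> G x ord0 i = gi x}.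
    by have [[gi mgi Ggi] _] := mG i; exists gi.
  have [g gP] := choice ex; exists g => i; [exact: (gP i).1|exact: (gP i).2].
pose G0 x : 'rV[R]_n.+1 := \row_i g i x.
have GG0 : {ae lebesgue_rV, forall x, Omega x -> G x = G0 x}.
  have : {ae lebesgue_rV, forall x, forall i, Omega x -> G x ord0 i = g i x}.
    exact: filter_forall.
  by apply: filterS => x Gx Ox; apply/rowP => i; rewrite mxE; exact: Gx.
have mG0 i : measurable_fun Omega (fun x => G0 x ord0 i).
  by under eq_fun do rewrite mxE; exact: mg.
have G0l : \int[lebesgue_rV]_(x in Omega) (`|enorm (G0 x)| `^ P)%:E <= (c1 * l `^ P)%:E.
  apply: (rho1 (fun x => enorm (G x))) => //; last exact: measurable_enorm.
  by apply: filterS GG0 => x Gx Ox; rewrite Gx.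
(* Both norms in the sum are nonnegative, hence each is below [e] and attained up to some admissible
   [e' < e]. *)
have close (e : R) : (0 < e)%R -> exists phi, [/\ C1_supported Omega phi,
    \int[lebesgue_rV]_(x in Omega) (`|u0 x - phi x| `^ P)%:E <= (c1 * e `^ P)%:E &
    \int[lebesgue_rV]_(x in Omega) (`|enorm (G0 x - gradient phi x)| `^ P)%:E
      <= (c1 * e `^ P)%:E].
  move=> e0; have [phi tphi small] := approx e e0.
  have C1phi := test_function_C1 tphi; have [cphi dphi cdphi _ _] := C1phi.
  exists phi; split => //.
  - have : LH_norm p q mu Omega (fun x => u x - phi x)%R < e%:E.
      by apply: le_lt_trans small; rewrite leeDl// LH_norm_ge0.
    move=> /LH_norm_lt[e' /andP[e'0 e'e] rho_e'].
    apply: (@le_trans _ _ (c1 * e' `^ P)%:E); last first.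
      by rewrite lee_fin ler_wpM2l// ler_powR2r// ltW.
    apply: (rho1 (fun x => u x - phi x)%R) => //.
      by apply: filterS uu0 => x ux Ox; rewrite ux.
    apply: measurable_funB => //; apply: (measurable_funS measurableT) => //.
    exact: continuous_measurable_rV.
  - have : LH_norm_vec p q mu Omega (fun x => G x - gradient phi x)%R < e%:E.
      by apply: le_lt_trans small; rewrite leeDr// LH_norm_ge0.
    move=> /LH_norm_lt[e' /andP[e'0 e'e] rho_e'].
    apply: (@le_trans _ _ (c1 * e' `^ P)%:E); last first.
      by rewrite lee_fin ler_wpM2l// ler_powR2r// ltW.
    apply: (rho1 (fun x => enorm (G x - gradient phi x))) => //.
      by apply: filterS GG0 => x Gx Ox; rewrite Gx.
    apply: measurable_enorm => // i; under eq_fun do rewrite !mxE.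
    apply: measurable_funB; first exact: mg.
    by apply: (measurable_funS measurableT) => //; exact: continuous_measurable_rV.
have phi_bound (e : R) phi : (0 < e)%R -> (e <= l)%R -> C1_supported Omega phi ->
    \int[lebesgue_rV]_(x in Omega) (`|enorm (G0 x - gradient phi x)| `^ P)%:E
      <= (c1 * e `^ P)%:E ->
    \int[lebesgue_rV]_(x in Omega) (`|phi x| `^ Q)%:E <= (K * (c2 * l) `^ Q)%:E.
  move=> e0 el C1phi gradphi; have [cphi dphi cdphi _ _] := C1phi.
  have l2 : (0 < c2 * l)%R by rewrite mulr_gt0// (lt_le_trans ltr01).
  apply: sobolev => //.
  apply: (@le_trans _ _ (\int[lebesgue_rV]_(x in Omega) (2 `^ P *
     (`|enorm (G0 x)| `^ P + `|enorm (G0 x - gradient phi x)| `^ P))%:E)).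
    apply: integral_monotone => x Ox; rewrite lee_fin.
    apply: powR_max2_le => //; [exact: ltW|exact: enorm_ge0|].
    rewrite !ger0_norm ?enorm_ge0//.
    have := enormD_le (G0 x) (- 1 *: (G0 x - gradient phi x))%R.
    by rewrite scaleN1r opprB addrC subrK -opprB -scaleN1r enormZ normrN1 mul1r.
  have mGphi : measurable_fun Omega (fun x => `|enorm (G0 x - gradient phi x)|%R).
    apply: measurableT_comp => //; apply: measurable_enorm => // i.
    under eq_fun do rewrite !mxE; apply: measurable_funB; first exact: mg.
    by apply: (measurable_funS measurableT) => //; exact: continuous_measurable_rV.
  have mG0n : measurable_fun Omega (fun x => `|enorm (G0 x)|%R).
    by apply: measurableT_comp => //; exact: measurable_enorm.
  have mA := measurable_powR_fun P mG0n; have mB := measurable_powR_fun P mGphi.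
  rewrite (ge0_integralZl_real _ mO (measurable_funD mA mB)) ?powR_ge0//; last first.
    by move=> x; rewrite addr_ge0 ?powR_ge0.
  rewrite (ge0_integralD_real _ mO mA mB); [|by move=> x; exact: powR_ge0..].
  apply: (@le_trans _ _ ((2 `^ P)%:E * ((c1 * l `^ P)%:E + (c1 * l `^ P)%:E))).
    apply: lee_wpmul2l; first by rewrite lee_fin powR_ge0.
    apply: (leeD G0l (le_trans gradphi _)).
    by rewrite lee_fin ler_wpM2l// ler_powR2r// ltW.
  rewrite -EFinD -EFinM lee_fin powRM ?(ltW l0) ?(le_trans ler01)//.
  rewrite -mulrDl mulrA ler_wpM2r ?powR_ge0//.
  apply: (@le_trans _ _ c2); first by rewrite lerDr.
  by apply: le1r_powR => //; exact: ltW.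
apply: integral_powR_trunc_le => //; [exact: measurableT_comp|exact: ltW|] => k.
apply/lee_addgt0Pr => eta eta0.
pose D : R := (2 `^ Q * (k.+1%:R `^ (Q - P) * c1))%R.
have D0 : (0 <= D)%R by rewrite mulr_ge0 ?powR_ge0// mulr_ge0 ?powR_ge0.
(* The bound by [l] serves [phi_bound], the bound by 1 gives [e^P <= e], and the last one makes
   [D e] at most [eta]. *)
pose e : R := Num.min l (Num.min 1 (eta / (D + 1)))%R.
have D10 : (0 < D + 1)%R by rewrite ltr_wpDl.
have e0 : (0 < e)%R by rewrite !lt_min l0 ltr01 divr_gt0.
have el : (e <= l)%R by rewrite ge_min lexx.
have e1 : (e <= 1)%R by rewrite !ge_min lexx orbT.
have eD : (D * e `^ P <= eta)%R.
  apply: (@le_trans _ _ (D * e)%R).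
    by rewrite ler_wpM2l//; apply: ge1r_powR; rewrite ?e0 ?e1 ?ltW.
  apply: (@le_trans _ _ ((D + 1) * (eta / (D + 1)))%R).
    rewrite ler_pM ?lerDl ?(ltW e0)//.
    by rewrite !ge_min lexx !orbT.
  by rewrite mulrC divfK ?gt_eqF.
have [phi [C1phi uphi gradphi]] := close e e0.
have [cphi _ _ _ _] := C1phi.
have mphi : measurable_fun Omega phi.
  by apply: (measurable_funS measurableT) => //; exact: continuous_measurable_rV.
have mA : measurable_fun Omega (fun x => `|phi x| `^ Q)%R.
  by apply: measurable_powR_fun; exact: measurableT_comp.
have mB : measurable_fun Omega (fun x => `|u0 x - phi x| `^ P)%R.
  apply: measurable_powR_fun; apply: measurableT_comp => //.
  exact: measurable_funB.
apply: (@le_trans _ _ (\int[lebesgue_rV]_(x in Omega) (2 `^ Q *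
    (`|phi x| `^ Q + k.+1%:R `^ (Q - P) * `|u0 x - phi x| `^ P))%:E)).
  apply: integral_monotone => x _; rewrite lee_fin; apply: powR_trunc_le => //.
  by rewrite -{1}[u0 x](subrK (phi x)) addrC ler_normD.
have mkB : measurable_fun Omega (fun x => k.+1%:R `^ (Q - P) * `|u0 x - phi x| `^ P)%R.
  exact: measurable_funM.
rewrite (ge0_integralZl_real _ mO (measurable_funD mA mkB)) ?powR_ge0//; last first.
  by move=> x; rewrite addr_ge0 ?mulr_ge0 ?powR_ge0.
rewrite (ge0_integralD_real _ mO mA mkB); last 2 first.
- by move=> x; exact: powR_ge0.
- by move=> x; rewrite mulr_ge0 ?powR_ge0.
rewrite (ge0_integralZl_real _ mO mB) ?powR_ge0//.
apply: (@le_trans _ _ ((2 `^ Q)%:E * ((K * (c2 * l) `^ Q)%:E +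
    (k.+1%:R `^ (Q - P))%:E * (c1 * e `^ P)%:E))).
  apply: lee_wpmul2l; first by rewrite lee_fin powR_ge0.
  apply: leeD; first exact: phi_bound gradphi.
  by apply: (lee_wpmul2l _ uphi); rewrite lee_fin powR_ge0.
rewrite -!(EFinM, EFinD) lee_fin mulrDr lerD//.
  by rewrite powRM ?(ltW l0) ?(le_trans ler01)// !mulrA.
by move: eD; rewrite /D !mulrA.
Qed.

(** Every [l] admissible in the norm of [G] makes [k * l] admissible in the norm of [u]; the infimum
    over [l] is then taken. *)
Lemma poincare_LH : exists2 C : R, (0 < C)%R & forall u G,
  in_W01H p q mu Omega u G ->
  LH_norm p q mu Omega u <= C%:E * LH_norm_vec p q mu Omega G.
Proof.
have [S S0 HS] := integral_powR_W01H.
have [k k0 Hk] := powR_rho_H_le1 OL oO P2 PQ M0 H_ae S0.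
exists k => // u G uG.
have [[[u0 mu0 uu0] _] _ _] := uG.1.
rewrite -lee_pdivrMl//; apply: le_ereal_inf_tmp => _ [l [l0 Gl] <-].
rewrite lee_pdivrMl// -EFinM.
apply: LH_norm_le; first exact: mulr_gt0.
exact: (Hk u u0 l uu0 mu0 l0 (HS u G u0 l uG mu0 uu0 l0 Gl)).
Qed.

End poincare.

(** * Extraction of the constants from the hypotheses *)

Lemma bounded_set_box (R : realType) n (A : set 'rV[R]_n) :
  bounded_set A -> exists2 L : R, 0 <= L & A `<=` box L.
Proof.
move=> [M [_ /(_ (Num.max 0 (M + 1)))]].
rewrite lt_max ltrDl ltr01 orbT => /(_ isT) AM.
exists (Num.max 0 (M + 1)); first by rewrite le_max lexx.
move=> x Ax i; apply: le_trans (AM x Ax).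
by rewrite [leRHS]mx_normrE; exact: (le_bigmax_cond _ (j := (ord0, i))).
Qed.

Theorem proposition3p13 (R : realType) (d : nat) (Omega : set 'rV[R]_d)
    (mu : 'rV[R]_d -> R) (p q : 'rV[R]_d -> R -> R) :
  (2 <= d)%N ->
  is_domain Omega -> bounded_set Omega -> lipschitz_boundary Omega ->
  lebesgue_measurable Omega mu ->
  (ess_sup_on lebesgue_rV Omega (fun x => `|mu x|%R) < +oo)%E ->
  {ae lebesgue_rV, forall x, Omega x -> 0 <= mu x} ->
  (forall x t, Omega x -> 0 <= t -> 2 <= p x t) ->
  (forall x t, Omega x -> 0 <= t -> 2 <= q x t) ->
  caratheodory Omega p -> caratheodory Omega q ->
  (2%:E <= exponent_inf Omega p)%E ->
  (exponent_inf Omega p <= exponent_sup Omega p)%E ->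
  (exponent_sup Omega p <= d%:R%:E)%E ->
  (2%:E <= exponent_inf Omega q)%E ->
  (exponent_inf Omega q <= exponent_sup Omega q)%E ->
  (exponent_sup Omega q < +oo)%E ->
  {ae lebesgue_rV, forall x, Omega x -> forall t, 0 <= t -> p x t <= q x t} ->
  {ae lebesgue_rV, forall x, Omega x ->
    exponent_growth (p x) /\ exponent_growth (q x)} ->
  lipschitz_on_set (closure Omega) mu ->
  (exists2 cp, 0 < cp & forall t x y, 0 <= t -> Omega x -> Omega y ->
    `|p x t - p y t| <= cp * enorm (x - y)) ->
  (exists2 cq, 0 < cq & forall t x y, 0 <= t -> Omega x -> Omega y ->
    `|q x t - q y t| <= cq * enorm (x - y)) ->
  fine (exponent_sup Omega q) / fine (exponent_inf Omega p) < 1 + d%:R^-1 ->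
  exists2 C : R, 0 < C & forall u G, in_W01H p q mu Omega u G ->
    (LH_norm p q mu Omega u <= C%:E * LH_norm_vec p q mu Omega G)%E.
Proof.
case: d => [//|n] in Omega mu p q *.
move=> _ [_ oO _] bO _ _ mu_fin mu0 _ q2 _ _ p_inf p_le p_sup q_inf q_le q_fin pq
  growth _ _ _ ratio.
have [L L0 OL] := bounded_set_box bO.
have [M1 muM1] := ess_sup_norm_ae mu_fin.
pose M := Num.max 0 M1; have M0 : 0 <= M by rewrite le_max lexx.
have gp : {ae lebesgue_rV, forall x, Omega x -> exponent_growth (p x)}.
  by apply: filterS growth => x gx /gx[].
have gq : {ae lebesgue_rV, forall x, Omega x -> exponent_growth (q x)}.
  by apply: filterS growth => x gx /gx[].
(* [fine] sends infinite values to 0, so the two essential bounds are first shown to be finite. *)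
have infE : (exponent_inf Omega p = (fine (exponent_inf Omega p))%:E)%E.
  rewrite fineK// fin_numElt (lt_le_trans _ p_inf) ?ltNyr//=.
  by rewrite (le_lt_trans p_le)// (le_lt_trans p_sup)// ltry.
have supE : (exponent_sup Omega q = (fine (exponent_sup Omega q))%:E)%E.
  rewrite fineK// fin_numElt q_fin andbT.
  by rewrite (lt_le_trans _ q_le)// (lt_le_trans _ q_inf)// ltNyr.
move: (fine _) (fine _) infE supE ratio => Q' P infE supE ratio.
rewrite infE lee_fin in p_inf.
have P0 : 0 < P by rewrite (lt_le_trans _ p_inf).
(* The maximum gives [P <= Q] at once and keeps the ratio bound, since [P / P = 1]. *)
pose Q := Num.max Q' P.
have PQ : P <= Q by rewrite le_max lexx orbT.
have QP : Q / P <= 1 + n.+1%:R^-1.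
  rewrite ler_pdivrMr// ge_max -ler_pdivrMr// (ltW ratio)/=.
  by rewrite ler_peMl ?(ltW P0)// lerDl invr_ge0.
have pP : {ae lebesgue_rV, forall x, Omega x -> forall t, 0 <= t -> P <= p x t}.
  by apply: exponent_inf_ae gp; rewrite infE.
have qQ : {ae lebesgue_rV, forall x, Omega x -> forall t, 0 <= t -> q x t <= Q}.
  by apply: exponent_sup_ae gq; rewrite supE lee_fin le_max lexx.
have pqQ : {ae lebesgue_rV, forall x, Omega x -> forall t, 0 <= t ->
    p x t <= Q /\ q x t <= Q}.
  apply: filterS2 pq qQ => x pqx qQx Ox t t0.
  by split; [exact: le_trans (pqx Ox t t0) (qQx Ox t t0)|exact: qQx].
have muM : {ae lebesgue_rV, forall x, Omega x -> 0 <= mu x /\ mu x <= M}.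
  apply: filterS2 mu0 muM1 => x mu0x muM1x Ox.
  by split; [exact: mu0x|rewrite le_max muM1x ?orbT].
have Q2 : 2 <= Q by exact: le_trans PQ.
apply: (poincare_LH L0 OL oO p_inf PQ M0 QP).
apply: filterS3 pP pqQ muM => x pPx pqQx muMx Ox t.
have [mu0x muMx'] := muMx Ox.
have q2x s : 0 <= s -> 2 <= q x s by exact: q2.
have pQx s : 0 <= s -> p x s <= Q by move=> s0; exact: (pqQx Ox s s0).1.
have qQx s : 0 <= s -> q x s <= Q by move=> s0; exact: (pqQx Ox s s0).2.
split.
- exact: (big_H_ge0 p_inf mu0x (pPx Ox) q2x).
- exact: (big_H_ge p_inf Q2 mu0x muMx' (pPx Ox) pQx q2x qQx).
- exact: (big_H_le p_inf Q2 mu0x muMx' (pPx Ox) pQx q2x qQx).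
Qed.
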